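(* Let either $a>0$ and $b>0$ be real, or $a\in\mathbb{C}\setminus\{0\}$ with $\mathrm{Re}\,a>0$ and $b=\overline{a}$. Let $m=2k$ with $k\in\mathbb{N}$, and let $\alpha\in\mathbb{C}$. Suppose that any one of the following conditions holds: (i) $ab\leq 1$ and $|\alpha|\,(2B(a,b)-1)\leq 1$; (ii) $ab\geq\max\left\{1,\frac{a+b}{2}\right\}$ and $|\alpha|\leq 2B(a,b)-1$. Then the formula $(\mathrm{Re}\,f(z),\mathrm{Im}\,f(z),t(z))$, $z\in\mathbb{D}$, defines a minimal surface, where $$f(z)=zF(a,b;a+b;z)+\overline{\frac{\alpha z^{2k+1}}{2k+1}\Big\{F(a,b;a+b;z)\ast F(2,2k+1;2k+2;z)\Big\}}$$ and $$t(z)=2\,\mathrm{Im}\Big\{\frac{\sqrt{\alpha}\,z^{k+1}}{k+1}\big[F(a,b;a+b;z)\ast F(2,k+1;k+2;z)\big]\Big\}+c,\qquad c\in\mathbb{R},$$ whose projection is $f(z)$.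
   Context: $\mathbb{D}=\{z\in\mathbb{C}:|z|<1\}$, $\mathbb{N}=\{1,2,\dots\}$. $F(a,b;c;z)=\sum_{n=0}^{\infty}\frac{(a,n)(b,n)}{(c,n)(1,n)}z^n$ is the Gaussian hypergeometric function, where $(a,0)=1$ for $a\neq 0$ and $(a,n)=a(a+1)\cdots(a+n-1)$ for $n\ge1$. $B(a,b)=\Gamma(a)\Gamma(b)/\Gamma(a+b)$ is the beta function, with $\Gamma$ the gamma function. $\ast$ is the Hadamard product of power series: $(\sum c_nz^n)\ast(\sum d_nz^n)=\sum c_nd_nz^n$. $\sqrt{\alpha}$ denotes a fixed square root of $\alpha$, and the $c$ in the formula for $t(z)$ is an arbitrary real constant. The surface lies in $\mathbb{R}^3$ and is parametrized by $z\in\mathbb{D}$; its projection is the projection $(u,v,t)\mapsto u+iv$ onto the base plane.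
   Formalization: ''Minimal surface'' here allows branch points; freedom from them is asserted in case (ii), and in case (i) only if ab ≤ (a+b)/2 (automatic for real a, b), since e.g. a = 0.1+0.9i, b = conj(a) satisfies (i) but gives a branch point. *)

(* Defs.v *)
From Stdlib Require Import Reals.
From Coquelicot Require Import Coquelicot.

Open Scope R_scope.

Definition Cseries (u : nat -> C) : C :=
  (Series (fun n => Re (u n)), Series (fun n => Im (u n))).

Definition power_series (c : nat -> C) (z : C) : C :=
  Cseries (fun n => (c n * z ^ n)%C).

(* Hadamard product, on coefficient sequences. *)
Definition hadamard (c d : nat -> C) : nat -> C := fun n => (c n * d n)%C.

(* The shifted factorial (a,n) = a (a+1) ... (a+n-1). *)
Fixpoint shifted_factorial (a : C) (n : nat) : C :=
  match n with
  | O => RtoC 1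
  | S m => (shifted_factorial a m * (a + RtoC (INR m)))%C
  end.

Definition F_coef (a b c : C) : nat -> C := fun n =>
  (shifted_factorial a n * shifted_factorial b n
   / (shifted_factorial c n * shifted_factorial (RtoC 1) n))%C.

Definition F (a b c z : C) : C := power_series (F_coef a b c) z.

(* t^w = exp (w ln t) for real t > 0 and complex w. *)
Definition Rcpower (t : R) (w : C) : C :=
  (Rpower t (Re w) * cos (Im w * ln t), Rpower t (Re w) * sin (Im w * ln t)).

(* Euler's integral of t^(z-1) e^(-t) over (0,+oo).  It converges, and hence
   is the gamma function, for Re z > 0; no other arguments are used. *)
Definition Gamma (z : C) : C :=
  RInt_gen (V := C_R_CompleteNormedModule)
    (fun t : R => (Rcpower t (z - RtoC 1) * RtoC (exp (- t)))%C)
    (at_right 0) (Rbar_locally p_infty).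

Definition Beta (a b : C) : C := (Gamma a * Gamma b / Gamma (a + b))%C.

Definition in_disk (z : C) : Prop := Cmod z < 1.

Definition vec3 : Type := (R * R * R)%type.

Definition crd1 (p : vec3) : R := fst (fst p).
Definition crd2 (p : vec3) : R := snd (fst p).
Definition crd3 (p : vec3) : R := snd p.

Definition dot (p q : vec3) : R :=
  crd1 p * crd1 q + crd2 p * crd2 q + crd3 p * crd3 q.

Definition cross (p q : vec3) : vec3 :=
  (crd2 p * crd3 q - crd3 p * crd2 q,
   crd3 p * crd1 q - crd1 p * crd3 q,
   crd1 p * crd2 q - crd2 p * crd1 q).

Definition scal3 (r : R) (p : vec3) : vec3 :=
  (r * crd1 p, r * crd2 p, r * crd3 p).

(* Partial derivatives with respect to x and y, where z = x + iy. *)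
Definition dx (u : C -> R) (z : C) : R :=
  Derive (fun x : R => u (x, Im z)) (Re z).
Definition dy (u : C -> R) (z : C) : R :=
  Derive (fun y : R => u (Re z, y)) (Im z).

Fixpoint Cn_on_disk (n : nat) (u : C -> R) : Prop :=
  (forall z : C, in_disk z -> continuous u z) /\
  match n with
  | O => True
  | S m =>
      (forall z : C, in_disk z ->
         ex_derive (fun x : R => u (x, Im z)) (Re z) /\
         ex_derive (fun y : R => u (Re z, y)) (Im z)) /\
      Cn_on_disk m (dx u) /\ Cn_on_disk m (dy u)
  end.

Definition harmonic_on_disk (u : C -> R) : Prop :=
  Cn_on_disk 2 u /\
  forall z : C, in_disk z -> dx (dx u) z + dy (dy u) z = 0.

Definition coordinatewise (d : (C -> R) -> C -> R) (X : C -> vec3) : C -> vec3 :=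
  fun z => (d (fun w => crd1 (X w)) z,
            d (fun w => crd2 (X w)) z,
            d (fun w => crd3 (X w)) z).

Definition Dx : (C -> vec3) -> C -> vec3 := coordinatewise dx.
Definition Dy : (C -> vec3) -> C -> vec3 := coordinatewise dy.

Definition normal (X : C -> vec3) (z : C) : vec3 := cross (Dx X z) (Dy X z).

(* The tangent vectors X_x, X_y are linearly independent at z. *)
Definition regular_at (X : C -> vec3) (z : C) : Prop :=
  normal X z <> (0, 0, 0).

Definition unit_normal (X : C -> vec3) (z : C) : vec3 :=
  scal3 (/ sqrt (dot (normal X z) (normal X z))) (normal X z).

(* H = (e G - 2 f F + g E) / (2 (E G - F^2)), where E, F, G and e, f, g are
   the coefficients of the first and second fundamental forms. *)
Definition mean_curvature (X : C -> vec3) (z : C) : R :=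
  let E1 := dot (Dx X z) (Dx X z) in
  let F1 := dot (Dx X z) (Dy X z) in
  let G1 := dot (Dy X z) (Dy X z) in
  let e2 := dot (Dx (Dx X) z) (unit_normal X z) in
  let f2 := dot (Dy (Dx X) z) (unit_normal X z) in
  let g2 := dot (Dy (Dy X) z) (unit_normal X z) in
  (e2 * G1 - 2 * f2 * F1 + g2 * E1) / (2 * (E1 * G1 - F1 * F1)).

Definition isothermal_at (X : C -> vec3) (z : C) : Prop :=
  dot (Dx X z) (Dx X z) = dot (Dy X z) (Dy X z) /\
  dot (Dx X z) (Dy X z) = 0.

(* Minimal surfaces in isothermal parameters, branch points being allowed:
   non-constant, conformal, with harmonic coordinates (Osserman's generalized
   minimal surfaces, whose non-regular points are isolated).  The last clause,
   the vanishing of the mean curvature, follows from the others; it is spelled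
   out because for a surface without branch points it is the classical
   definition. *)
Definition minimal_surface (X : C -> vec3) : Prop :=
  (exists z w : C, in_disk z /\ in_disk w /\ X z <> X w) /\
  (harmonic_on_disk (fun z => crd1 (X z)) /\
   harmonic_on_disk (fun z => crd2 (X z)) /\
   harmonic_on_disk (fun z => crd3 (X z))) /\
  (forall z : C, in_disk z -> isothermal_at X z) /\
  (forall z : C, in_disk z -> regular_at X z -> mean_curvature X z = 0).

Definition immersed (X : C -> vec3) : Prop :=
  forall z : C, in_disk z -> regular_at X z.

Definition base_projection (p : vec3) : C := (crd1 p, crd2 p).

Definition admissible (a b : C) : Prop :=
  (Im a = 0 /\ Im b = 0 /\ 0 < Re a /\ 0 < Re b) \/
  (a <> RtoC 0 /\ 0 < Re a /\ b = Cconj a).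

(* For admissible (a,b) the numbers ab, a+b and B(a,b) are real, so they are
   compared through their real parts. *)
Definition cond_i (a b alpha : C) : Prop :=
  Re (a * b)%C <= 1 /\ Cmod alpha * (2 * Re (Beta a b) - 1) <= 1.

Definition cond_ii (a b alpha : C) : Prop :=
  Rmax 1 (Re (a + b)%C / 2) <= Re (a * b)%C /\
  Cmod alpha <= 2 * Re (Beta a b) - 1.

Definition nC (n : nat) : C := RtoC (INR n).

Definition f_map (a b alpha : C) (k : nat) (z : C) : C :=
  (z * F a b (a + b) z
   + Cconj (alpha * z ^ (2 * k + 1) / nC (2 * k + 1)
            * power_series
                (hadamard (F_coef a b (a + b))
                   (F_coef (nC 2) (nC (2 * k + 1)) (nC (2 * k + 2)))) z))%C.

(* s is the chosen square root of alpha. *)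
Definition t_map (a b s : C) (k : nat) (c : R) (z : C) : R :=
  2 * Im (s * z ^ (k + 1) / nC (k + 1)
          * power_series
              (hadamard (F_coef a b (a + b))
                 (F_coef (nC 2) (nC (k + 1)) (nC (k + 2)))) z)%C
  + c.

Definition lift (a b alpha s : C) (k : nat) (c : R) (z : C) : vec3 :=
  (Re (f_map a b alpha k z), Im (f_map a b alpha k z), t_map a b s k c z).

(* Main.v *)
Require Import Defs.
From Stdlib Require Import Reals Lra Lia Classical.
From Coquelicot Require Import Coquelicot.

Open Scope R_scope.

(** Write [A n] for the Taylor coefficients of [F(a,b;a+b;z)] and put
    [h(z) = z F(a,b;a+b;z)], so that [h'(z) = sum (n+1) (A n) z^n].  The factor
    [F(2,N+1;N+2;z)] has coefficients [(n+1)(N+1)/(n+N+1)]; Hadamard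
    multiplication by it turns [z^{N+1}/(N+1)] times [F(a,b;a+b;z)] into a
    primitive of [z^N h'].  Hence [f] is [h] plus the conjugate of [g], where
    [g' = alpha z^{2k} h' = (s z^k)^2 h'], and [t] is [2 Im] of a primitive of
    [s z^k h'].  These are Weierstrass data: the coordinates are the real parts
    of primitives of
    [h' (1 + q^2)], [- i h' (1 - q^2)], [- 2 i q h'] with [q = s z^k], whose
    squares add up to 0 ([lift_weierstrass_data]).  So the map is harmonic and
    conformal on the disk, which makes its mean curvature vanish where it is
    regular; it is not constant because [h'(0) = 1].

    Regularity at [z] amounts to [h'(z) <> 0], which is where the conditions on
    [a] and [b] enter.  With [c n = (n+1) (A n)], the sign of [c (n+1) - c n]
    is that of [(ab - 1) n + (2ab - (a+b))].  Thus [c] decreases when [ab <= 1]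
    and [ab <= (a+b)/2], and increases when [ab >= max(1, (a+b)/2)].  In both
    cases the Enestroem-Kakeya argument applied to [(1 - z) h'(z)] shows that
    [h'] has no zero in the disk ([power_series_neq_0_of_variation]): in the
    decreasing case without further conditions, in the increasing case provided
    that [c n <= 2] for all [n].

    The latter follows from [c n * B(a,b) <= 1], since condition (ii) forces
    [B(a,b) >= 1/2].  From [Gamma(z+1) = z Gamma(z)],
    [|Gamma z| <= Gamma(Re z)] and the Chebyshev inequality
    [Gamma(u+x) Gamma(u+y) <= Gamma(u) Gamma(u+x+y)] one gets
    [c n * |B(a,b)| <= (n+1)/n] ([zero_balanced_coef_Beta_le]), and because [c]
    increases, letting the index tend to infinity improves the bound to 1
    ([hprime_coef_Beta_le]). *)

(** * Complex power series in the unit disk *)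

Lemma Rabs_Im_le_Cmod (z : C) : Rabs (Im z) <= Cmod z.
Proof.
  apply Rle_trans with (2 := Rmax_Cmod z). apply Rmax_r.
Qed.

Lemma Cmod_INR (n : nat) : Cmod (RtoC (INR n)) = INR n.
Proof. rewrite Cmod_R. apply Rabs_pos_eq, pos_INR. Qed.

Lemma RtoC_INR_neq_0 (n : nat) : n <> O -> RtoC (INR n) <> RtoC 0.
Proof. intros Hn H. apply (f_equal Re) in H. now apply (not_0_INR n). Qed.

Lemma ex_series_Rmult_l (c : R) (u : nat -> R) :
  ex_series u -> ex_series (fun n => c * u n).
Proof. exact (ex_series_scal (K := R_AbsRing) (V := R_NormedModule) c u). Qed.

Lemma Cseries_ext (u v : nat -> C) :
  (forall n, u n = v n) -> Cseries u = Cseries v.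
Proof.
  intros H. unfold Cseries. f_equal; apply Series_ext; intros n; now rewrite H.
Qed.

Lemma ex_series_Re (u : nat -> C) :
  ex_series (fun n => Cmod (u n)) -> ex_series (fun n => Re (u n)).
Proof.
  apply (ex_series_le (K := R_AbsRing) (V := R_CompleteNormedModule)).
  intros n. apply re_le_Cmod.
Qed.

Lemma ex_series_Im (u : nat -> C) :
  ex_series (fun n => Cmod (u n)) -> ex_series (fun n => Im (u n)).
Proof.
  apply (ex_series_le (K := R_AbsRing) (V := R_CompleteNormedModule)).
  intros n. apply Rabs_Im_le_Cmod.
Qed.

Lemma Cseries_plus (u v : nat -> C) :
  ex_series (fun n => Cmod (u n)) -> ex_series (fun n => Cmod (v n)) ->
  Cseries (fun n => u n + v n)%C = (Cseries u + Cseries v)%C.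
Proof.
  intros Hu Hv. unfold Cseries, Cplus at 3. simpl. f_equal.
  - apply (Series_plus (fun n => Re (u n)) (fun n => Re (v n)));
      now apply ex_series_Re.
  - apply (Series_plus (fun n => Im (u n)) (fun n => Im (v n)));
      now apply ex_series_Im.
Qed.

Lemma Cseries_scal (a : C) (u : nat -> C) :
  ex_series (fun n => Cmod (u n)) ->
  Cseries (fun n => a * u n)%C = (a * Cseries u)%C.
Proof.
  intros Hu. pose proof (ex_series_Re _ Hu) as Hr.
  pose proof (ex_series_Im _ Hu) as Hi.
  unfold Cseries, Cmult at 3. simpl. f_equal.
  - rewrite <- 2!Series_scal_l. rewrite <- Series_minus.
    + reflexivity.
    + now apply ex_series_Rmult_l.
    + now apply ex_series_Rmult_l.
  - rewrite <- 2!Series_scal_l. rewrite <- Series_plus.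
    + reflexivity.
    + now apply ex_series_Rmult_l.
    + now apply ex_series_Rmult_l.
Qed.

Lemma Cseries_incr_1 (u : nat -> C) :
  ex_series (fun n => Cmod (u n)) ->
  Cseries u = (u O + Cseries (fun n => u (S n)))%C.
Proof.
  intros Hu. unfold Cseries, Cplus. simpl. f_equal.
  - now apply Series_incr_1, ex_series_Re.
  - now apply Series_incr_1, ex_series_Im.
Qed.

(** With [L] the sum, [|L|^2] is the real part of the series of the
    [Cconj L * u n], to which the real triangle inequality applies. *)
Lemma Cmod_Cseries_le (u : nat -> C) :
  ex_series (fun n => Cmod (u n)) ->
  Cmod (Cseries u) <= Series (fun n => Cmod (u n)).
Proof.
  intros Hu. set (L := Cseries u).
  assert (Hs : ex_series (fun n => Cmod (Cconj L * u n))).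
  { apply ex_series_ext with (fun n => Cmod L * Cmod (u n)).
    - intros n. now rewrite Cmod_mult, Cmod_conj.
    - now apply ex_series_Rmult_l. }
  assert (H : Cmod L * Cmod L <= Cmod L * Series (fun n => Cmod (u n))).
  { replace (Cmod L * Cmod L) with (Re (Cconj L * L)).
    2:{ replace (Cmod L * Cmod L) with (Cmod L ^ 2) by ring.
        rewrite Cmod2_alt. unfold Cconj, Cmult, Re, Im. simpl. ring. }
    unfold L at 2. rewrite <- Cseries_scal by exact Hu.
    change (Series (fun n => Re (Cconj L * u n)%C)
            <= Cmod L * Series (fun n => Cmod (u n))).
    apply Rle_trans with (1 := Rle_abs _).
    rewrite <- Series_scal_l.
    eapply Rle_trans; [apply Series_Rabs|].
    - apply (ex_series_le (K := R_AbsRing) (V := R_CompleteNormedModule))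
        with (2 := Hs).
      intros n.
      change (Rabs (Rabs (Re (Cconj L * u n))) <= Cmod (Cconj L * u n)).
      rewrite Rabs_Rabsolu. apply re_le_Cmod.
    - apply Series_le.
      + intros n. split; [apply Rabs_pos|].
        rewrite <- (Cmod_conj L), <- Cmod_mult. apply re_le_Cmod.
      + now apply ex_series_Rmult_l. }
  destruct (Cmod_ge_0 L) as [Hp|Hz].
  - now apply Rmult_le_reg_l with (Cmod L).
  - rewrite <- Hz.
    replace 0 with (Series (fun _ : nat => 0 * 0)).
    + apply Series_le; [|exact Hu]. intros n. rewrite Rmult_0_l.
      split; [lra | apply Cmod_ge_0].
    + rewrite Series_scal_l. ring.
Qed.

(** Convergence of the power series in the open unit disk.  In this form it
    passes to dominated sequences and to sums; the form [CV_radius >= 1] below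
    makes it pass to derivatives. *)
Definition disk_coefs (d : nat -> C) : Prop :=
  forall r, 0 <= r < 1 -> ex_series (fun n => Cmod (d n) * r ^ n).

Lemma disk_coefs_CV_radius (d : nat -> C) :
  disk_coefs d <-> Rbar_le 1 (CV_radius (fun n => Cmod (d n))).
Proof.
  split.
  - intros Hd. apply Rbar_not_lt_le. intros Hlt.
    pose proof (CV_radius_ge_0 (fun n => Cmod (d n))) as H0.
    destruct (CV_radius (fun n => Cmod (d n))) as [R0| |] eqn:E;
      try easy. simpl in Hlt, H0.
    assert (Hr : 0 <= (R0 + 1) / 2 < 1) by lra.
    apply (CV_disk_outside (fun n => Cmod (d n)) ((R0 + 1) / 2)).
    + rewrite E. simpl. rewrite Rabs_pos_eq; lra.
    + now apply ex_series_lim_0, Hd.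
  - intros Hd r Hr.
    apply ex_series_ext with (fun n => Rabs (Cmod (d n) * r ^ n)).
    + intros n. apply Rabs_pos_eq, Rmult_le_pos;
        [apply Cmod_ge_0 | apply pow_le; lra].
    + apply CV_disk_inside. apply Rbar_lt_le_trans with (2 := Hd).
      simpl. rewrite Rabs_pos_eq; lra.
Qed.

Lemma disk_coefs_le (d e : nat -> C) :
  (forall n, Cmod (d n) <= Cmod (e n)) -> disk_coefs e -> disk_coefs d.
Proof.
  intros Hle He r Hr.
  apply (ex_series_le (K := R_AbsRing) (V := R_CompleteNormedModule))
    with (2 := He r Hr).
  intros n. change (Rabs (Cmod (d n) * r ^ n) <= Cmod (e n) * r ^ n).
  assert (Hp : 0 <= r ^ n) by (apply pow_le; lra).
  rewrite Rabs_pos_eq.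
  - now apply Rmult_le_compat_r.
  - apply Rmult_le_pos; [apply Cmod_ge_0 | exact Hp].
Qed.

Lemma disk_coefs_plus (d e : nat -> C) :
  disk_coefs d -> disk_coefs e -> disk_coefs (fun n => d n + e n)%C.
Proof.
  intros Hd He r Hr.
  apply (ex_series_le (K := R_AbsRing) (V := R_CompleteNormedModule))
    with (fun n => Cmod (d n) * r ^ n + Cmod (e n) * r ^ n).
  - intros n. change (Rabs (Cmod (d n + e n) * r ^ n)
                      <= Cmod (d n) * r ^ n + Cmod (e n) * r ^ n).
    assert (Hp : 0 <= r ^ n) by (apply pow_le; lra).
    rewrite Rabs_pos_eq, <- Rmult_plus_distr_r.
    + apply Rmult_le_compat_r; [exact Hp | apply Cmod_triangle].
    + apply Rmult_le_pos; [apply Cmod_ge_0 | exact Hp].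
  - exact (ex_series_plus (K := R_AbsRing) (V := R_NormedModule) _ _
             (Hd r Hr) (He r Hr)).
Qed.

Lemma disk_coefs_scal (a : C) (d : nat -> C) :
  disk_coefs d -> disk_coefs (fun n => a * d n)%C.
Proof.
  intros Hd r Hr.
  apply ex_series_ext with (fun n => Cmod a * (Cmod (d n) * r ^ n)).
  - intros n. rewrite Cmod_mult. symmetry. apply Rmult_assoc.
  - apply ex_series_Rmult_l, Hd, Hr.
Qed.

Definition deriv_coef (d : nat -> C) : nat -> C :=
  fun n => (RtoC (INR (S n)) * d (S n))%C.

Lemma disk_coefs_deriv (d : nat -> C) :
  disk_coefs d -> disk_coefs (deriv_coef d).
Proof.
  rewrite 2!disk_coefs_CV_radius. intros Hd.
  rewrite (CV_radius_ext _ (PS_derive (fun n => Cmod (d n)))).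
  - now rewrite CV_radius_derive.
  - intros n. unfold deriv_coef, PS_derive. now rewrite Cmod_mult, Cmod_INR.
Qed.

Lemma disk_coefs_mul_S (d : nat -> C) :
  disk_coefs d -> disk_coefs (fun n => RtoC (INR (S n)) * d n)%C.
Proof.
  rewrite 2!disk_coefs_CV_radius. intros Hd.
  rewrite (CV_radius_ext _ (PS_derive (PS_incr_1 (fun n => Cmod (d n))))).
  - now rewrite CV_radius_derive, CV_radius_incr_1.
  - intros n. unfold PS_derive. now rewrite Cmod_mult, Cmod_INR.
Qed.

(** The coefficients of [z^N] times the series. *)
Fixpoint shift_coef (N : nat) (d : nat -> C) : nat -> C :=
  match N with
  | O => d
  | S M => fun n => match n with O => RtoC 0 | S m => shift_coef M d m end
  end.

Lemma disk_coefs_shift (N : nat) (d : nat -> C) :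
  disk_coefs d -> disk_coefs (shift_coef N d).
Proof.
  intros Hd. induction N as [|N IH]; [exact Hd|].
  rewrite disk_coefs_CV_radius in *.
  rewrite (CV_radius_ext _ (PS_incr_1 (fun n => Cmod (shift_coef N d n)))).
  - now rewrite CV_radius_incr_1.
  - intros [|n]; [apply Cmod_0 | reflexivity].
Qed.

Lemma disk_coefs_ex_series (d : nat -> C) (z : C) :
  disk_coefs d -> in_disk z -> ex_series (fun n => Cmod (d n * z ^ n)).
Proof.
  intros Hd Hz.
  apply ex_series_ext with (fun n => Cmod (d n) * Cmod z ^ n).
  - intros n. now rewrite Cmod_mult, Cmod_pow.
  - apply Hd. split; [apply Cmod_ge_0 | exact Hz].
Qed.

Lemma power_series_ext (d e : nat -> C) (z : C) :
  (forall n, d n = e n) -> power_series d z = power_series e z.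
Proof. intros H. apply Cseries_ext. intros n. now rewrite H. Qed.

Lemma power_series_plus (d e : nat -> C) (z : C) :
  disk_coefs d -> disk_coefs e -> in_disk z ->
  power_series (fun n => d n + e n)%C z
  = (power_series d z + power_series e z)%C.
Proof.
  intros Hd He Hz. unfold power_series.
  rewrite <- Cseries_plus by now apply disk_coefs_ex_series.
  apply Cseries_ext. intros n. ring.
Qed.

Lemma power_series_scal (a : C) (d : nat -> C) (z : C) :
  disk_coefs d -> in_disk z ->
  power_series (fun n => a * d n)%C z = (a * power_series d z)%C.
Proof.
  intros Hd Hz. unfold power_series.
  rewrite <- Cseries_scal by now apply disk_coefs_ex_series.
  apply Cseries_ext. intros n. ring.
Qed.

Lemma power_series_shift (N : nat) (d : nat -> C) (z : C) :
  disk_coefs d -> in_disk z ->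
  power_series (shift_coef N d) z = (z ^ N * power_series d z)%C.
Proof.
  intros Hd Hz. induction N as [|N IH].
  - simpl. ring.
  - unfold power_series at 1.
    rewrite Cseries_incr_1
      by (apply disk_coefs_ex_series; [now apply disk_coefs_shift | exact Hz]).
    rewrite (Cseries_ext _ (fun n => z * (shift_coef N d n * z ^ n))%C)
      by (intros n; simpl; ring).
    rewrite Cseries_scal
      by (apply disk_coefs_ex_series; [now apply disk_coefs_shift | exact Hz]).
    fold (power_series (shift_coef N d) z). rewrite IH. simpl. ring.
Qed.

Lemma power_series_0 (d : nat -> C) :
  disk_coefs d -> power_series d (RtoC 0) = d O.
Proof.
  intros Hd. unfold power_series.
  assert (H0 : in_disk (RtoC 0)) by (unfold in_disk; rewrite Cmod_0; lra).
  rewrite Cseries_incr_1 by now apply disk_coefs_ex_series.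
  rewrite (Cseries_ext _ (fun n => 0 * (d (S n) * 0 ^ n))%C)
    by (intros n; simpl; ring).
  rewrite Cseries_scal.
  - simpl. ring.
  - apply disk_coefs_ex_series; [|exact H0].
    intros r Hr.
    apply (ex_series_le (K := R_AbsRing) (V := R_CompleteNormedModule))
      with (2 := disk_coefs_deriv d Hd r Hr).
    intros n. unfold deriv_coef. rewrite Cmod_mult, Cmod_INR.
    assert (Hp : 0 <= Cmod (d (S n)) * r ^ n)
      by (apply Rmult_le_pos; [apply Cmod_ge_0 | apply pow_le; lra]).
    change (Rabs (Cmod (d (S n)) * r ^ n)
            <= INR (S n) * Cmod (d (S n)) * r ^ n).
    rewrite Rabs_pos_eq by exact Hp. rewrite Rmult_assoc.
    rewrite <- (Rmult_1_l (Cmod (d (S n)) * r ^ n)) at 1.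
    apply Rmult_le_compat_r; [exact Hp|]. rewrite S_INR.
    pose proof (pos_INR n). lra.
Qed.

(** The remainders [e n = w^{n+1} - z^{n+1} - (n+1) z^n (w - z)] obey the
    recursion [e (n+1) = w (e n) + (n+1) z^n (w - z)^2]. *)
Lemma pow_taylor_remainder (z w : C) (r : R) (n : nat) :
  Cmod z <= r -> Cmod w <= r ->
  r * Cmod (w ^ S n - z ^ S n - RtoC (INR (S n)) * z ^ n * (w - z))
  <= INR (S n) * INR (S n) * r ^ n * Cmod (w - z) ^ 2.
Proof.
  intros Hz Hw.
  assert (Hr : 0 <= r) by (apply Rle_trans with (2 := Hz); apply Cmod_ge_0).
  set (D := Cmod (w - z) ^ 2).
  assert (HD : 0 <= D) by apply pow2_ge_0.
  assert (H : r * Cmod (w ^ S n - z ^ S n - RtoC (INR (S n)) * z ^ n * (w - z))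
              <= INR n * INR (S n) * r ^ n * D).
  { induction n as [|n IH].
    - replace (w ^ 1 - z ^ 1 - RtoC (INR 1) * z ^ 0 * (w - z))%C with (RtoC 0).
      + rewrite Cmod_0. simpl. lra.
      + simpl. ring.
    - replace (w ^ S (S n) - z ^ S (S n)
               - RtoC (INR (S (S n))) * z ^ S n * (w - z))%C
        with (w * (w ^ S n - z ^ S n - RtoC (INR (S n)) * z ^ n * (w - z))
              + RtoC (INR (S n)) * z ^ n * (w - z) ^ 2)%C.
      2:{ rewrite (S_INR (S n)), RtoC_plus. simpl. ring. }
      set (e := (w ^ S n - z ^ S n - RtoC (INR (S n)) * z ^ n * (w - z))%C)
        in *.
      assert (He : Cmod (w * e + RtoC (INR (S n)) * z ^ n * (w - z) ^ 2)
                   <= r * Cmod e + INR (S n) * r ^ n * D).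
      { eapply Rle_trans; [apply Cmod_triangle|].
        rewrite !Cmod_mult, 2!Cmod_pow, Cmod_INR. fold D.
        apply Rplus_le_compat.
        - apply Rmult_le_compat_r; [apply Cmod_ge_0 | exact Hw].
        - apply Rmult_le_compat_r; [exact HD|].
          apply Rmult_le_compat_l; [apply pos_INR|].
          apply pow_incr. split; [apply Cmod_ge_0 | exact Hz]. }
      pose proof (Rmult_le_compat_l r _ _ Hr He) as H1.
      pose proof (Rmult_le_compat_l r _ _ Hr IH) as H2.
      assert (Hp : 0 <= r ^ S n * D)
        by (apply Rmult_le_pos; [now apply pow_le | exact HD]).
      pose proof (Rmult_le_pos _ _ (pos_INR (S n)) Hp) as H3.
      simpl pow in *. rewrite (S_INR (S n)), (S_INR n) in *. nra. }
  eapply Rle_trans; [exact H|].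
  apply Rmult_le_compat_r; [exact HD|].
  apply Rmult_le_compat_r; [now apply pow_le|].
  apply Rmult_le_compat_r; [apply pos_INR|]. apply le_INR. lia.
Qed.

(** A quadratic remainder, obtained by summing the remainders of the monomials,
    gives at once the partial derivatives and the continuity of the real
    part. *)
Lemma power_series_taylor (d : nat -> C) (z : C) :
  disk_coefs d -> in_disk z ->
  exists delta K, 0 < delta /\ 0 <= K /\
    forall w, Cmod (w - z) < delta -> in_disk w /\
      Cmod (power_series d w - power_series d z
            - power_series (deriv_coef d) z * (w - z))
      <= K * Cmod (w - z) ^ 2.
Proof.
  intros Hd Hz. pose proof (Cmod_ge_0 z) as Hz0. unfold in_disk in Hz.
  (* Both [z] and all [w] considered lie in the disk of radius [r < 1]. *)
  set (r := (1 + Cmod z) / 2).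
  assert (Hr : 0 < r < 1) by (unfold r; lra).
  set (q := fun n => (RtoC (INR (S n)) * deriv_coef d n)%C).
  assert (Hq : disk_coefs q) by now apply disk_coefs_mul_S, disk_coefs_deriv.
  assert (Hqr : ex_series (fun n => Cmod (q n) * r ^ n)) by (apply Hq; lra).
  set (M := Series (fun n => Cmod (q n) * r ^ n)).
  exists ((1 - Cmod z) / 2), (Rabs (M / r)).
  split; [lra|]. split; [apply Rabs_pos|]. intros w Hw.
  assert (Hwr : Cmod w <= r).
  { replace w with (z + (w - z))%C by ring.
    eapply Rle_trans; [apply Cmod_triangle|]. unfold r. lra. }
  assert (Hwd : in_disk w) by (unfold in_disk; lra).
  split; [exact Hwd|].
  set (D := Cmod (w - z) ^ 2). assert (HD : 0 <= D) by apply pow2_ge_0.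
  set (e := fun n => (w ^ S n - z ^ S n - RtoC (INR (S n)) * z ^ n * (w - z))%C).
  assert (Hb : forall n, Cmod (d (S n) * e n)
                         <= D / r * (Cmod (q n) * r ^ n)).
  { intros n. apply Rmult_le_reg_l with r; [lra|].
    rewrite Cmod_mult.
    replace (r * (D / r * (Cmod (q n) * r ^ n)))
      with (Cmod (d (S n)) * (INR (S n) * INR (S n) * r ^ n * D)).
    - replace (r * (Cmod (d (S n)) * Cmod (e n)))
        with (Cmod (d (S n)) * (r * Cmod (e n))) by ring.
      apply Rmult_le_compat_l; [apply Cmod_ge_0|].
      apply pow_taylor_remainder; [unfold r; lra | exact Hwr].
    - unfold q, deriv_coef. rewrite !Cmod_mult, Cmod_INR. field. lra. }
  assert (Hbs : ex_series (fun n => D / r * (Cmod (q n) * r ^ n)))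
    by now apply ex_series_Rmult_l.
  assert (Hes : ex_series (fun n => Cmod (d (S n) * e n))).
  { apply (ex_series_le (K := R_AbsRing) (V := R_CompleteNormedModule))
      with (2 := Hbs).
    intros n. eapply Rle_trans; [|apply Hb].
    apply Req_le, Rabs_pos_eq, Cmod_ge_0. }
  assert (Hin : forall v, in_disk v ->
            ex_series (fun n => Cmod (d (S n) * v ^ S n))).
  { intros v Hv. apply (ex_series_incr_1 (K := R_AbsRing)
      (V := R_NormedModule) (fun n => Cmod (d n * v ^ n))).
    now apply disk_coefs_ex_series. }
  assert (Heq : (power_series d w - power_series d z
                 - power_series (deriv_coef d) z * (w - z))%C
                = Cseries (fun n => d (S n) * e n)%C).
  { unfold power_series.
    rewrite (Cseries_incr_1 (fun n => d n * w ^ n)%C)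
      by now apply disk_coefs_ex_series.
    rewrite (Cseries_incr_1 (fun n => d n * z ^ n)%C)
      by now apply disk_coefs_ex_series.
    assert (Hdz : ex_series (fun n => Cmod (deriv_coef d n * z ^ n)))
      by (apply disk_coefs_ex_series; [now apply disk_coefs_deriv | exact Hz]).
    rewrite (Cseries_ext (fun n => d (S n) * e n)%C
       (fun n => d (S n) * w ^ S n
                 + (- (1) * (d (S n) * z ^ S n)
                    + - (w - z) * (deriv_coef d n * z ^ n))))%C
      by (intros n; unfold e, deriv_coef; ring).
    rewrite Cseries_plus, Cseries_plus, Cseries_scal, Cseries_scal.
    - simpl. ring.
    - exact Hdz.
    - now apply Hin.
    - apply ex_series_ext with (fun n => Cmod (- (1)) * Cmod (d (S n) * z ^ S n)).
      + intros n. now rewrite <- Cmod_mult.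
      + now apply ex_series_Rmult_l, Hin.
    - apply ex_series_ext
        with (fun n => Cmod (- (w - z)) * Cmod (deriv_coef d n * z ^ n)).
      + intros n. now rewrite <- Cmod_mult.
      + now apply ex_series_Rmult_l.
    - now apply Hin.
    - apply (ex_series_le (K := R_AbsRing) (V := R_CompleteNormedModule))
        with (fun n => Cmod (d (S n) * e n) + Cmod (d (S n) * w ^ S n)).
      + intros n.
        change (Rabs (Cmod (- (1) * (d (S n) * z ^ S n)
                    + - (w - z) * (deriv_coef d n * z ^ n)))
          <= Cmod (d (S n) * e n) + Cmod (d (S n) * w ^ S n)).
        rewrite Rabs_pos_eq by apply Cmod_ge_0.
        rewrite <- (Cmod_opp (d (S n) * w ^ S n)).
        eapply Rle_trans; [|apply Cmod_triangle].
        apply Req_le. f_equal. unfold e, deriv_coef. ring.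
      + apply (ex_series_plus (K := R_AbsRing) (V := R_NormedModule));
          [exact Hes | now apply Hin]. }
  rewrite Heq. eapply Rle_trans; [now apply Cmod_Cseries_le|].
  eapply Rle_trans.
  { apply Series_le; [|exact Hbs].
    intros n. split; [apply Cmod_ge_0 | apply Hb]. }
  rewrite Series_scal_l. fold M.
  replace (D / r * M) with (M / r * D) by (field; lra).
  apply Rmult_le_compat_r; [exact HD | apply Rle_abs].
Qed.

(** * Real parts of power series are harmonic *)

Lemma is_derive_of_quadratic_remainder (phi : R -> R) (x l delta K : R) :
  0 < delta -> 0 <= K ->
  (forall h, Rabs h < delta ->
     Rabs (phi (x + h) - phi x - l * h) <= K * Rabs h ^ 2) ->
  is_derive phi x l.
Proof.
  intros Hd HK H. apply is_derive_Reals. intros eps Heps.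
  assert (Hm : 0 < Rmin delta (eps / (K + 1))).
  { apply Rmin_pos; [exact Hd|]. apply Rdiv_lt_0_compat; lra. }
  exists (mkposreal _ Hm). intros h Hh0 Hh. simpl in Hh.
  assert (Hh1 : Rabs h < delta) by (eapply Rlt_le_trans, Rmin_l; exact Hh).
  assert (Hh2 : Rabs h < eps / (K + 1))
    by (eapply Rlt_le_trans, Rmin_r; exact Hh).
  specialize (H h Hh1).
  assert (Hp : 0 < Rabs h) by now apply Rabs_pos_lt.
  replace ((phi (x + h) - phi x) / h - l)
    with ((phi (x + h) - phi x - l * h) / h) by now field.
  rewrite Rabs_div by exact Hh0.
  apply Rmult_lt_reg_r with (Rabs h); [exact Hp|].
  replace (Rabs (phi (x + h) - phi x - l * h) / Rabs h * Rabs h)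
    with (Rabs (phi (x + h) - phi x - l * h)) by (field; lra).
  eapply Rle_lt_trans; [exact H|].
  assert (H3 : Rabs h * (K + 1) < eps).
  { apply Rmult_lt_reg_r with (/ (K + 1)); [apply Rinv_0_lt_compat; lra|].
    replace (Rabs h * (K + 1) * / (K + 1)) with (Rabs h) by (field; lra).
    exact Hh2. }
  nra.
Qed.

Definition Re_power_series (u : C -> R) (d : nat -> C) : Prop :=
  disk_coefs d /\ forall z, in_disk z -> u z = Re (power_series d z).

Lemma Re_power_series_taylor (u : C -> R) (d : nat -> C) (z : C) :
  Re_power_series u d -> in_disk z ->
  exists delta K, 0 < delta /\ 0 <= K /\
    forall w, Cmod (w - z) < delta ->
      Rabs (u w - u z - Re (power_series (deriv_coef d) z * (w - z)))
      <= K * Cmod (w - z) ^ 2.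
Proof.
  intros [Hd Hu] Hz.
  destruct (power_series_taylor d z Hd Hz) as (delta & K & Hdl & HK & H).
  exists delta, K. split; [exact Hdl|]. split; [exact HK|].
  intros w Hw. destruct (H w Hw) as [Hwd Hb].
  rewrite (Hu w Hwd), (Hu z Hz).
  eapply Rle_trans; [|exact Hb].
  exact (re_le_Cmod (power_series d w - power_series d z
                     - power_series (deriv_coef d) z * (w - z))).
Qed.

Lemma is_derive_x (u : C -> R) (d : nat -> C) (z : C) :
  Re_power_series u d -> in_disk z ->
  is_derive (fun x : R => u (x, Im z)) (Re z)
    (Re (power_series (deriv_coef d) z)).
Proof.
  intros Hu Hz.
  destruct (Re_power_series_taylor u d z Hu Hz) as (delta & K & Hdl & HK & H).
  apply is_derive_of_quadratic_remainder with delta K; [exact Hdl|exact HK|].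
  intros h Hh.
  assert (Hw : Cminus (Re z + h, Im z) z = RtoC h).
  { destruct z as [x y]. unfold Cminus, Cplus, Copp, RtoC. simpl. f_equal; ring. }
  specialize (H (Re z + h, Im z)). rewrite Hw, Cmod_R in H.
  specialize (H Hh). replace (Re z, Im z) with z by now destruct z.
  replace (Re (power_series (deriv_coef d) z) * h)
    with (Re (power_series (deriv_coef d) z * RtoC h)%C).
  - exact H.
  - destruct (power_series (deriv_coef d) z). simpl. ring.
Qed.

Lemma is_derive_y (u : C -> R) (d : nat -> C) (z : C) :
  Re_power_series u d -> in_disk z ->
  is_derive (fun y : R => u (Re z, y)) (Im z)
    (Re (Ci * power_series (deriv_coef d) z)%C).
Proof.
  intros Hu Hz.
  destruct (Re_power_series_taylor u d z Hu Hz) as (delta & K & Hdl & HK & H).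
  apply is_derive_of_quadratic_remainder with delta K; [exact Hdl|exact HK|].
  intros h Hh.
  assert (Hw : Cminus (Re z, Im z + h) z = (Ci * RtoC h)%C).
  { destruct z as [x y]. unfold Cminus, Cplus, Copp, RtoC, Ci, Cmult. simpl.
    f_equal; ring. }
  specialize (H (Re z, Im z + h)).
  rewrite Hw, Cmod_mult, Cmod_R, Cmod_Ci, Rmult_1_l in H.
  specialize (H Hh). replace (Re z, Im z) with z by now destruct z.
  replace (Re (Ci * power_series (deriv_coef d) z)%C * h)
    with (Re (power_series (deriv_coef d) z * (Ci * RtoC h))%C).
  - exact H.
  - destruct (power_series (deriv_coef d) z). simpl. ring.
Qed.

Lemma Re_power_series_continuous (u : C -> R) (d : nat -> C) (z : C) :
  Re_power_series u d -> in_disk z -> continuous u z.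
Proof.
  intros Hu Hz.
  destruct (Re_power_series_taylor u d z Hu Hz) as (delta & K & Hdl & HK & H).
  set (L := power_series (deriv_coef d) z) in *.
  apply filterlim_locally. intros eps.
  pose proof (cond_pos eps) as Heps. pose proof (Cmod_ge_0 L) as HL.
  (* For [|w - z| < 1] the quadratic remainder is at most [K |w - z|].  The
     balls of the product uniformity are squares, hence the factor 1/2 below. *)
  set (m := Rmin 1 (Rmin delta (eps / (K + Cmod L + 1)))).
  assert (Hm : 0 < m / 2).
  { apply Rdiv_lt_0_compat; [|lra]. apply Rmin_pos; [lra|].
    apply Rmin_pos; [exact Hdl|]. apply Rdiv_lt_0_compat; lra. }
  exists (mkposreal _ Hm). intros w Hw.
  assert (Hwm : Cmod (w - z) < m).
  { eapply Rlt_trans; [exact (C_NormedModule_mixin_compat2 z w _ Hw)|].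
    change (sqrt 2 * (m / 2) < m).
    assert (Hs : sqrt 2 < 2) by (apply sqrt_less; lra).
    pose proof (Rmult_lt_compat_r (m / 2) _ _ Hm Hs). lra. }
  assert (Hw1 : Cmod (w - z) < 1) by (eapply Rlt_le_trans, Rmin_l; exact Hwm).
  assert (Hwr : Cmod (w - z) < Rmin delta (eps / (K + Cmod L + 1)))
    by (eapply Rlt_le_trans, Rmin_r; exact Hwm).
  assert (Hwd : Cmod (w - z) < delta)
    by (eapply Rlt_le_trans, Rmin_l; exact Hwr).
  assert (Hwe : Cmod (w - z) < eps / (K + Cmod L + 1))
    by (eapply Rlt_le_trans, Rmin_r; exact Hwr).
  assert (He : Cmod (w - z) * (K + Cmod L + 1) < eps).
  { apply Rmult_lt_reg_r with (/ (K + Cmod L + 1));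
      [apply Rinv_0_lt_compat; lra|].
    replace (Cmod (w - z) * (K + Cmod L + 1) * / (K + Cmod L + 1))
      with (Cmod (w - z)) by (field; lra).
    exact Hwe. }
  specialize (H w Hwd).
  assert (HLw : Rabs (Re (L * (w - z))%C) <= Cmod L * Cmod (w - z))
    by (rewrite <- Cmod_mult; apply re_le_Cmod).
  change (Rabs (u w - u z) < eps).
  replace (u w - u z)
    with ((u w - u z - Re (L * (w - z))%C) + Re (L * (w - z))%C) by ring.
  eapply Rle_lt_trans; [apply Rabs_triang|].
  pose proof (Cmod_ge_0 (w - z)) as Hw0.
  assert (HKx : K * Cmod (w - z) ^ 2 <= K * Cmod (w - z)).
  { apply Rmult_le_compat_l; [exact HK|]. simpl. nra. }
  lra.
Qed.

Lemma Re_power_series_dx (u : C -> R) (d : nat -> C) :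
  Re_power_series u d -> Re_power_series (dx u) (deriv_coef d).
Proof.
  intros Hu. split; [now apply disk_coefs_deriv, Hu|].
  intros z Hz. apply is_derive_unique. now apply is_derive_x.
Qed.

Lemma Re_power_series_dy (u : C -> R) (d : nat -> C) :
  Re_power_series u d ->
  Re_power_series (dy u) (fun n => Ci * deriv_coef d n)%C.
Proof.
  intros Hu. assert (Hd : disk_coefs (deriv_coef d))
    by now apply disk_coefs_deriv, Hu.
  split; [now apply disk_coefs_scal|].
  intros z Hz. rewrite power_series_scal by assumption.
  apply is_derive_unique. now apply is_derive_y.
Qed.

(** Both partial derivatives are again real parts of power series, so the
    induction on the order of differentiability never leaves this class. *)
Lemma Re_power_series_Cn (n : nat) (u : C -> R) (d : nat -> C) :
  Re_power_series u d -> Cn_on_disk n u.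
Proof.
  revert u d. induction n as [|n IH]; intros u d Hu.
  - split; [|exact I]. intros z. now apply Re_power_series_continuous with d.
  - split; [|split; [|split]].
    + intros z. now apply Re_power_series_continuous with d.
    + intros z Hz. split; eexists.
      * now apply is_derive_x with (1 := Hu).
      * now apply is_derive_y with (1 := Hu).
    + exact (IH _ _ (Re_power_series_dx _ _ Hu)).
    + exact (IH _ _ (Re_power_series_dy _ _ Hu)).
Qed.

Lemma Re_power_series_harmonic (u : C -> R) (d : nat -> C) :
  Re_power_series u d -> harmonic_on_disk u.
Proof.
  intros Hu. split; [now apply Re_power_series_Cn with d|].
  intros z Hz.
  destruct (Re_power_series_dx _ _ (Re_power_series_dx _ _ Hu)) as [Hd Hxx].
  destruct (Re_power_series_dy _ _ (Re_power_series_dy _ _ Hu)) as [_ Hyy].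
  rewrite (Hxx z Hz), (Hyy z Hz).
  rewrite (power_series_ext
             (fun n => Ci * deriv_coef (fun m => Ci * deriv_coef d m) n)%C
             (fun n => - (1) * deriv_coef (deriv_coef d) n)%C).
  - rewrite power_series_scal by assumption.
    destruct (power_series (deriv_coef (deriv_coef d)) z).
    unfold Re, Cmult, Copp, RtoC. simpl. ring.
  - intros n. unfold deriv_coef.
    transitivity (Ci * Ci * (RtoC (INR (S n)) * (RtoC (INR (S (S n)))
                   * d (S (S n)))))%C; [ring|].
    replace (Ci * Ci)%C with (- (1))%C by
      (unfold Ci, Cmult, Copp, RtoC; simpl; f_equal; ring).
    reflexivity.
Qed.

Lemma dx_Re_power_series (u : C -> R) (d : nat -> C) (z : C) :
  Re_power_series u d -> in_disk z ->
  dx u z = Re (power_series (deriv_coef d) z).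
Proof. intros Hu. now apply Re_power_series_dx. Qed.

Lemma dy_Re_power_series (u : C -> R) (d : nat -> C) (z : C) :
  Re_power_series u d -> in_disk z ->
  dy u z = - Im (power_series (deriv_coef d) z).
Proof.
  intros Hu Hz.
  replace (- Im (power_series (deriv_coef d) z))
    with (Re (Ci * power_series (deriv_coef d) z)%C) by (simpl; ring).
  apply is_derive_unique. now apply is_derive_y.
Qed.

(** * Conformal harmonic maps of the disk into space *)

(** In isothermal parameters [E = G] and [F = 0], so the numerator of the mean
    curvature is [E] times the normal component of the Laplacian of [X]. *)
Lemma mean_curvature_harmonic_conformal (X : C -> vec3) (z : C) :
  in_disk z -> isothermal_at X z ->
  harmonic_on_disk (fun w => crd1 (X w)) ->
  harmonic_on_disk (fun w => crd2 (X w)) ->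
  harmonic_on_disk (fun w => crd3 (X w)) ->
  mean_curvature X z = 0.
Proof.
  intros Hz [HE HF] [_ H1] [_ H2] [_ H3].
  specialize (H1 z Hz). specialize (H2 z Hz). specialize (H3 z Hz).
  unfold mean_curvature. rewrite HF, <- HE.
  set (n := unit_normal X z).
  assert (HL : dot (Defs.Dx (Defs.Dx X) z) n + dot (Dy (Dy X) z) n = 0).
  { change (dx (dx (fun w => crd1 (X w))) z * crd1 n
            + dx (dx (fun w => crd2 (X w))) z * crd2 n
            + dx (dx (fun w => crd3 (X w))) z * crd3 n
            + (dy (dy (fun w => crd1 (X w))) z * crd1 n
               + dy (dy (fun w => crd2 (X w))) z * crd2 n
               + dy (dy (fun w => crd3 (X w))) z * crd3 n) = 0).
    apply Rplus_opp_r_uniq in H1, H2, H3. rewrite H1, H2, H3. ring. }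
  apply Rplus_opp_r_uniq in HL. rewrite HL. unfold Rdiv. ring.
Qed.

(** The Weierstrass-Enneper representation.  The map is conformal because
    [X_x = Re phi] and [X_y = - Im phi]: the real part of
    [phi1^2 + phi2^2 + phi3^2 = 0] is [E = G] and its imaginary part is
    [F = 0]. *)
Definition weierstrass_data (X : C -> vec3) (phi1 phi2 phi3 : C -> C) : Prop :=
  exists d1 d2 d3,
    (Re_power_series (fun z => crd1 (X z)) d1 /\
     Re_power_series (fun z => crd2 (X z)) d2 /\
     Re_power_series (fun z => crd3 (X z)) d3) /\
    forall z, in_disk z ->
      power_series (deriv_coef d1) z = phi1 z /\
      power_series (deriv_coef d2) z = phi2 z /\
      power_series (deriv_coef d3) z = phi3 z /\
      (phi1 z * phi1 z + phi2 z * phi2 z + phi3 z * phi3 z)%C = RtoC 0.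

Lemma weierstrass_Dx_Dy (X : C -> vec3) (phi1 phi2 phi3 : C -> C) (z : C) :
  weierstrass_data X phi1 phi2 phi3 -> in_disk z ->
  Defs.Dx X z = (Re (phi1 z), Re (phi2 z), Re (phi3 z)) /\
  Dy X z = (- Im (phi1 z), - Im (phi2 z), - Im (phi3 z)).
Proof.
  intros (d1 & d2 & d3 & (H1 & H2 & H3) & H) Hz.
  destruct (H z Hz) as (<- & <- & <- & _).
  unfold Defs.Dx, Dy, coordinatewise.
  now rewrite (dx_Re_power_series _ _ _ H1), (dx_Re_power_series _ _ _ H2),
    (dx_Re_power_series _ _ _ H3), (dy_Re_power_series _ _ _ H1),
    (dy_Re_power_series _ _ _ H2), (dy_Re_power_series _ _ _ H3).
Qed.

Lemma weierstrass_isothermal (X : C -> vec3) (phi1 phi2 phi3 : C -> C) (z : C) :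
  weierstrass_data X phi1 phi2 phi3 -> in_disk z -> isothermal_at X z.
Proof.
  intros HX Hz. pose proof (weierstrass_Dx_Dy _ _ _ _ _ HX Hz) as [Ex Ey].
  destruct HX as (d1 & d2 & d3 & _ & H).
  destruct (H z Hz) as (_ & _ & _ & H0).
  unfold isothermal_at. rewrite Ex, Ey.
  destruct (phi1 z) as [x1 y1], (phi2 z) as [x2 y2], (phi3 z) as [x3 y3].
  unfold Cmult, Cplus, RtoC in H0. simpl in H0. injection H0 as Hr Hi.
  unfold dot, crd1, crd2, crd3. simpl. split; lra.
Qed.

(** Lagrange's identity: [|X_x x X_y|^2 = E G - F^2], which is [E^2] for a
    conformal map. *)
Lemma dot_cross (p q : vec3) :
  dot (cross p q) (cross p q) = dot p p * dot q q - dot p q * dot p q.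
Proof.
  destruct p as [[p1 p2] p3], q as [[q1 q2] q3].
  unfold dot, cross, crd1, crd2, crd3. simpl. ring.
Qed.

Lemma weierstrass_regular (X : C -> vec3) (phi1 phi2 phi3 : C -> C) (z : C) :
  weierstrass_data X phi1 phi2 phi3 -> in_disk z ->
  phi1 z <> RtoC 0 \/ phi2 z <> RtoC 0 \/ phi3 z <> RtoC 0 ->
  regular_at X z.
Proof.
  intros HX Hz Hphi Hn.
  pose proof (weierstrass_isothermal _ _ _ _ _ HX Hz) as [HE HF].
  pose proof (weierstrass_Dx_Dy _ _ _ _ _ HX Hz) as [Ex Ey].
  pose proof (dot_cross (Defs.Dx X z) (Dy X z)) as HL.
  fold (normal X z) in HL. rewrite Hn, HF in HL.
  assert (H0 : dot (Defs.Dx X z) (Defs.Dx X z) = 0).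
  { rewrite <- HE in HL. unfold dot at 1, crd1, crd2, crd3 in HL. simpl in HL.
    apply Rsqr_0_uniq. unfold Rsqr. lra. }
  rewrite H0 in HE. rewrite Ex in H0. rewrite Ey in HE.
  destruct (phi1 z) as [x1 y1], (phi2 z) as [x2 y2], (phi3 z) as [x3 y3].
  unfold dot, crd1, crd2, crd3 in H0, HE. simpl in H0, HE.
  assert (x1 = 0) by nra. assert (x2 = 0) by nra. assert (x3 = 0) by nra.
  assert (y1 = 0) by nra. assert (y2 = 0) by nra. assert (y3 = 0) by nra.
  subst. now destruct Hphi as [Hp|[Hp|Hp]]; apply Hp.
Qed.

Lemma dx_locally_constant (u : C -> R) (z : C) (l : R) :
  in_disk z -> (forall w, in_disk w -> u w = l) -> dx u z = 0.
Proof.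
  intros Hz Hu. unfold dx. rewrite <- (Derive_const l (Re z)).
  apply Derive_ext_loc. unfold in_disk in Hz.
  assert (Hd : 0 < 1 - Cmod z) by lra.
  enough (H : forall x : R, Rabs (x - Re z) < 1 - Cmod z -> u (x, Im z) = l)
    by (exists (mkposreal _ Hd); exact H).
  intros x Hx. apply Hu. unfold in_disk.
  apply Rle_lt_trans with (Cmod (z + RtoC (x - Re z))).
  - apply Req_le. f_equal. destruct z as [a b]. unfold Cplus, RtoC. simpl.
    f_equal; ring.
  - eapply Rle_lt_trans; [apply Cmod_triangle|]. rewrite Cmod_R. lra.
Qed.

(** If the map were constant on the disk, its derivative [X_x] would vanish
    everywhere, although it does not vanish at a regular point. *)
Lemma regular_not_constant (X : C -> vec3) (z : C) :
  in_disk z -> regular_at X z ->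
  exists v w, in_disk v /\ in_disk w /\ X v <> X w.
Proof.
  intros Hz Hr. apply NNPP. intros Hn. apply Hr.
  assert (Hc : forall w, in_disk w -> X w = X z).
  { intros w Hw. apply NNPP. intros Hne. apply Hn. now exists w, z. }
  unfold normal. replace (Defs.Dx X z) with ((0, 0, 0) : vec3).
  - unfold cross, crd1, crd2, crd3. simpl. f_equal; [f_equal|]; ring.
  - unfold Defs.Dx, coordinatewise.
    rewrite (dx_locally_constant (fun w => crd1 (X w)) z (crd1 (X z)));
      [|exact Hz|intros w Hw; now rewrite Hc].
    rewrite (dx_locally_constant (fun w => crd2 (X w)) z (crd2 (X z)));
      [|exact Hz|intros w Hw; now rewrite Hc].
    rewrite (dx_locally_constant (fun w => crd3 (X w)) z (crd3 (X z)));
      [|exact Hz|intros w Hw; now rewrite Hc].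
    reflexivity.
Qed.

Lemma weierstrass_minimal_surface (X : C -> vec3) (phi1 phi2 phi3 : C -> C)
    (z : C) :
  weierstrass_data X phi1 phi2 phi3 ->
  in_disk z -> regular_at X z -> minimal_surface X.
Proof.
  intros HX Hz Hr. split; [now apply regular_not_constant with z|].
  assert (Hh : harmonic_on_disk (fun z => crd1 (X z)) /\
               harmonic_on_disk (fun z => crd2 (X z)) /\
               harmonic_on_disk (fun z => crd3 (X z))).
  { destruct HX as (d1 & d2 & d3 & (H1 & H2 & H3) & _).
    split; [|split]; eapply Re_power_series_harmonic; eassumption. }
  split; [exact Hh|].
  assert (Hi : forall w, in_disk w -> isothermal_at X w)
    by (intros w; now apply weierstrass_isothermal with (1 := HX)).
  split; [exact Hi|]. intros w Hw _.
  apply mean_curvature_harmonic_conformal; try easy. now apply Hi.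
Qed.

(** * The zero-balanced hypergeometric coefficients *)

Lemma shifted_factorial_neq_0 (a : C) (n : nat) :
  0 < Re a -> shifted_factorial a n <> RtoC 0.
Proof.
  intros Ha. induction n as [|n IH]; simpl.
  - intros H. injection H. lra.
  - apply Cmult_neq_0; [exact IH|]. intros H.
    apply (f_equal Re) in H. simpl in H. unfold Re in Ha.
    pose proof (pos_INR n). lra.
Qed.

Lemma shifted_factorial_succ_base (a : C) (n : nat) :
  (a * shifted_factorial (a + RtoC 1) n
   = shifted_factorial a n * (a + RtoC (INR n)))%C.
Proof.
  induction n as [|n IH].
  - simpl. ring.
  - change (shifted_factorial (a + RtoC 1) (S n))
      with (shifted_factorial (a + RtoC 1) n * (a + RtoC 1 + RtoC (INR n)))%C.
    rewrite Cmult_assoc, IH.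
    change (shifted_factorial a (S n))
      with (shifted_factorial a n * (a + RtoC (INR n)))%C.
    rewrite S_INR, RtoC_plus. ring.
Qed.

Lemma admissible_real (a b : C) :
  admissible a b ->
  (a + b)%C = RtoC (Re (a + b)%C) /\ (a * b)%C = RtoC (Re (a * b)%C) /\
  0 < Re a /\ 0 < Re b /\ 0 < Re (a * b)%C.
Proof.
  destruct a as [x y], b as [u v].
  unfold admissible, Cplus, Cmult, Cconj, RtoC. simpl.
  intros [(-> & -> & Hx & Hu) | (_ & Hx & E)].
  - repeat split; try assumption; try (f_equal; ring). nra.
  - injection E as -> ->. repeat split; try assumption; try (f_equal; ring).
    nra.
Qed.

(** The Taylor coefficients of [F(a,b;a+b;z)] depend only on [s = a+b] and
    [p = ab], both real for admissible [(a,b)]. *)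
Fixpoint zero_balanced_coef (s p : R) (n : nat) : R :=
  match n with
  | O => 1
  | S m => zero_balanced_coef s p m
           * ((INR m * INR m + INR m * s + p) / ((s + INR m) * INR (S m)))
  end.

Lemma F_coef_zero_balanced (a b : C) (n : nat) :
  admissible a b ->
  F_coef a b (a + b) n
  = RtoC (zero_balanced_coef (Re (a + b)%C) (Re (a * b)%C) n).
Proof.
  intros Hab.
  destruct (admissible_real a b Hab) as (Hs & Hp & Ha & Hb & Hp0).
  assert (Hs0 : 0 < Re (a + b)%C) by (simpl; unfold Re in *; lra).
  set (s := Re (a + b)%C) in *. set (p := Re (a * b)%C) in *.
  rewrite Hs. unfold F_coef.
  assert (H1 : forall m, shifted_factorial (RtoC 1) m <> RtoC 0)
    by (intros m; apply shifted_factorial_neq_0; simpl; lra).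
  assert (H2 : forall m, shifted_factorial (RtoC s) m <> RtoC 0)
    by (intros m; apply shifted_factorial_neq_0; exact Hs0).
  induction n as [|n IH].
  - apply injective_projections; simpl; field.
  - pose proof (pos_INR n) as Hn.
    assert (H3 : (RtoC s + RtoC (INR n))%C <> RtoC 0)
      by (rewrite <- RtoC_plus; intros H; injection H; lra).
    assert (H4 : RtoC (INR (S n)) <> RtoC 0)
      by now apply RtoC_INR_neq_0.
    change (zero_balanced_coef s p (S n)) with (zero_balanced_coef s p n
      * ((INR n * INR n + INR n * s + p) / ((s + INR n) * INR (S n)))).
    rewrite RtoC_mult, <- IH, RtoC_div, !RtoC_plus, !RtoC_mult, !RtoC_plus.
    2:{ rewrite S_INR. nra. }
    rewrite <- Hp, <- Hs.
    specialize (H1 n). specialize (H2 n). rewrite <- Hs in H2, H3.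
    assert (H5 : (RtoC 1 + RtoC (INR n))%C = RtoC (INR (S n)))
      by now rewrite <- RtoC_plus, S_INR, Rplus_comm.
    revert H4 H5. generalize (RtoC (INR (S n))). intros m H4 H5. simpl.
    rewrite H5. field. tauto.
Qed.

Lemma zero_balanced_coef_pos (s p : R) (n : nat) :
  0 < s -> 0 < p -> 0 < zero_balanced_coef s p n.
Proof.
  intros Hs Hp. induction n as [|n IH]; cbn [zero_balanced_coef]; [lra|].
  pose proof (pos_INR n) as Hn. apply Rmult_lt_0_compat; [exact IH|].
  rewrite S_INR. apply Rdiv_lt_0_compat; nra.
Qed.

Lemma disk_coefs_zero_balanced (s p : R) :
  0 < s -> 0 < p -> disk_coefs (fun n => RtoC (zero_balanced_coef s p n)).
Proof.
  intros Hs Hp. apply disk_coefs_CV_radius.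
  set (A := zero_balanced_coef s p).
  assert (HA : forall n, 0 < A n)
    by (intros n; now apply zero_balanced_coef_pos).
  rewrite (CV_radius_ext _ A)
    by (intros n; rewrite Cmod_R; apply Rabs_pos_eq, Rlt_le, HA).
  rewrite (CV_radius_finite_DAlembert A 1).
  - simpl. lra.
  - intros n. specialize (HA n). lra.
  - lra.
  - apply is_lim_seq_ext with
      (fun n => (INR n * INR n + INR n * s + p) / ((s + INR n) * INR (S n))).
    { intros n. pose proof (pos_INR n) as Hn. rewrite Rabs_pos_eq.
      - unfold A. cbn [zero_balanced_coef]. fold (A n). specialize (HA n).
        field. rewrite S_INR. lra.
      - apply Rlt_le, Rdiv_lt_0_compat; apply HA. }
    (* The ratio differs from 1 by (p - s - n) / ((s + n) (n + 1)). *)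
    set (K := Rabs (p - s) / s + 1).
    assert (HK : is_lim_seq (fun n => K * / INR (S n)) 0).
    { replace (Finite 0) with (Rbar_mult K 0) by (simpl; f_equal; ring).
      apply is_lim_seq_scal_l, (is_lim_seq_incr_1 (fun n => / INR n)).
      replace (Finite 0) with (Rbar_inv p_infty) by reflexivity.
      apply is_lim_seq_inv; [apply is_lim_seq_INR | easy]. }
    apply is_lim_seq_le_le with (fun n => 1 - K * / INR (S n))
      (fun n => 1 + K * / INR (S n)).
    + intros n. pose proof (pos_INR n) as Hn.
      assert (HS : 0 < INR (S n)) by (rewrite S_INR; lra).
      assert (Hd : Rabs ((INR n * INR n + INR n * s + p)
                         / ((s + INR n) * INR (S n)) - 1)
                   <= K * / INR (S n)).
      { replace ((INR n * INR n + INR n * s + p)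
                 / ((s + INR n) * INR (S n)) - 1)
          with ((p - s - INR n) / (s + INR n) * / INR (S n))
          by (rewrite S_INR; field; lra).
        rewrite Rabs_mult, (Rabs_pos_eq (/ INR (S n)))
          by (apply Rlt_le, Rinv_0_lt_compat, HS).
        apply Rmult_le_compat_r; [apply Rlt_le, Rinv_0_lt_compat, HS|].
        rewrite Rabs_div, (Rabs_pos_eq (s + INR n)) by lra.
        apply Rmult_le_reg_r with (s + INR n); [lra|].
        replace (Rabs (p - s - INR n) / (s + INR n) * (s + INR n))
          with (Rabs (p - s - INR n)) by (field; lra).
        unfold Rminus at 1. eapply Rle_trans; [apply Rabs_triang|].
        rewrite Rabs_Ropp, (Rabs_pos_eq (INR n)) by exact Hn.
        replace (K * (s + INR n))
          with (Rabs (p - s) + s + Rabs (p - s) / s * INR n + INR n)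
          by (unfold K; field; lra).
        assert (0 <= Rabs (p - s) / s * INR n); [|lra].
        apply Rmult_le_pos; [|exact Hn].
        apply Rdiv_le_0_compat; [apply Rabs_pos | exact Hs]. }
      apply Rabs_le_between in Hd. lra.
    + replace (Finite 1) with (Rbar_minus 1 0) by (simpl; f_equal; ring).
      apply is_lim_seq_minus'; [apply is_lim_seq_const | exact HK].
    + replace (Finite 1) with (Rbar_plus 1 0) by (simpl; f_equal; ring).
      apply is_lim_seq_plus'; [apply is_lim_seq_const | exact HK].
Qed.

(** The coefficients of [h'] for [h(z) = z F(a,b;a+b;z)]. *)
Definition hprime_coef (s p : R) (n : nat) : R :=
  INR (S n) * zero_balanced_coef s p n.

Lemma hprime_coef_pos (s p : R) (n : nat) :
  0 < s -> 0 < p -> 0 < hprime_coef s p n.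
Proof.
  intros Hs Hp. apply Rmult_lt_0_compat; [apply lt_0_INR; lia|].
  now apply zero_balanced_coef_pos.
Qed.

(** The ratio of consecutive terms is
    [(n+2)(n^2 + s n + p) / ((n+1)^2 (n+s))]; the cubic and quadratic terms of
    numerator and denominator agree, which leaves [(p-1) n + (2p - s)]. *)
Lemma hprime_coef_step (s p : R) (n : nat) :
  0 < s ->
  hprime_coef s p (S n) - hprime_coef s p n
  = zero_balanced_coef s p n * ((p - 1) * INR n + (2 * p - s))
    / ((s + INR n) * INR (S n)).
Proof.
  intros Hs. pose proof (pos_INR n) as Hn. unfold hprime_coef.
  cbn [zero_balanced_coef]. rewrite !S_INR. field. lra.
Qed.

Lemma hprime_coef_increasing (s p : R) (n : nat) :
  0 < s -> 1 <= p -> s / 2 <= p -> hprime_coef s p n <= hprime_coef s p (S n).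
Proof.
  intros Hs H1 H2. pose proof (pos_INR n) as Hn.
  assert (HA := zero_balanced_coef_pos s p n Hs ltac:(lra)).
  apply Rminus_le_0. rewrite hprime_coef_step by exact Hs. rewrite S_INR.
  apply Rdiv_le_0_compat; [apply Rmult_le_pos|]; nra.
Qed.

Lemma hprime_coef_decreasing (s p : R) (n : nat) :
  0 < s -> 0 < p -> p <= 1 -> p <= s / 2 ->
  hprime_coef s p (S n) <= hprime_coef s p n.
Proof.
  intros Hs Hp H1 H2. pose proof (pos_INR n) as Hn.
  assert (HA := zero_balanced_coef_pos s p n Hs Hp).
  apply Rminus_le_0.
  replace (hprime_coef s p n - hprime_coef s p (S n))
    with (zero_balanced_coef s p n * ((1 - p) * INR n + (s - 2 * p))
          / ((s + INR n) * INR (S n))).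
  - rewrite S_INR. apply Rdiv_le_0_compat; [apply Rmult_le_pos|]; nra.
  - rewrite <- (Ropp_minus_distr (hprime_coef s p (S n))).
    rewrite hprime_coef_step by exact Hs.
    rewrite S_INR. field. lra.
Qed.

(** * Weierstrass data of the lift *)

Lemma shifted_factorial_two (n : nat) :
  shifted_factorial (nC 2) n
  = (RtoC (INR (S n)) * shifted_factorial (RtoC 1) n)%C.
Proof.
  assert (H := shifted_factorial_succ_base (RtoC 1) n).
  rewrite Cmult_1_l in H.
  replace (nC 2) with (RtoC 1 + RtoC 1)%C
    by (unfold nC; rewrite <- RtoC_plus; f_equal; simpl; ring).
  rewrite H, S_INR, RtoC_plus. ring.
Qed.

(** Since [(2,n) = (n+1) (1,n)] and [(N+1,n) (N+1+n) = (N+1) (N+2,n)].  Up to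
    the constant [N+1], the Hadamard product with this series turns
    [z^{N+1} sum A_n z^n] into a primitive of [z^N sum (n+1) A_n z^n]. *)
Lemma F_coef_two (N n : nat) :
  F_coef (nC 2) (nC (N + 1)) (nC (N + 2)) n
  = (nC (N + 1) * RtoC (INR (S n) / INR (n + (N + 1))))%C.
Proof.
  assert (Hpos : 0 < INR (N + 1)) by (apply lt_0_INR; lia).
  assert (HD := shifted_factorial_succ_base (nC (N + 1)) n).
  replace (nC (N + 1) + RtoC 1)%C with (nC (N + 2)) in HD
    by (unfold nC; rewrite <- RtoC_plus, <- S_INR; do 2 f_equal; lia).
  replace (nC (N + 1) + RtoC (INR n))%C with (RtoC (INR (n + (N + 1)))) in HD
    by (unfold nC; rewrite <- RtoC_plus, plus_INR; f_equal; ring).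
  unfold F_coef. rewrite shifted_factorial_two.
  assert (H1 : shifted_factorial (RtoC 1) n <> RtoC 0)
    by (apply shifted_factorial_neq_0; simpl; lra).
  assert (H2 : shifted_factorial (nC (N + 2)) n <> RtoC 0)
    by (apply shifted_factorial_neq_0; simpl; apply lt_0_INR; lia).
  assert (H3 : RtoC (INR (n + (N + 1))) <> RtoC 0)
    by (apply RtoC_INR_neq_0; lia).
  rewrite RtoC_div by (apply not_0_INR; lia).
  set (u := RtoC (INR (n + (N + 1)))) in *. set (v := RtoC (INR (S n))).
  transitivity (v * (shifted_factorial (nC (N + 1)) n * u)
                / (shifted_factorial (nC (N + 2)) n * u))%C.
  - field. tauto.
  - rewrite <- HD. field. tauto.
Qed.

Definition primitive_coef (N : nat) (A : nat -> C) : nat -> C :=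
  fun n => (RtoC (INR (S n) / INR (n + (N + 1))) * A n)%C.

Lemma disk_coefs_primitive (N : nat) (A : nat -> C) :
  disk_coefs A -> disk_coefs (primitive_coef N A).
Proof.
  apply disk_coefs_le. intros n. unfold primitive_coef.
  rewrite Cmod_mult. apply Rle_trans with (1 * Cmod (A n)); [|lra].
  apply Rmult_le_compat_r; [apply Cmod_ge_0|].
  assert (H : 0 < INR (n + (N + 1))) by (apply lt_0_INR; lia).
  rewrite Cmod_R, Rabs_pos_eq.
  - apply Rmult_le_reg_r with (1 := H).
    replace (INR (S n) / INR (n + (N + 1)) * INR (n + (N + 1)))
      with (INR (S n)) by (field; lra).
    rewrite Rmult_1_l. apply le_INR. lia.
  - apply Rdiv_le_0_compat; [apply pos_INR | exact H].
Qed.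

Lemma power_series_hadamard_two (N : nat) (A : nat -> C) (z : C) :
  disk_coefs A -> in_disk z ->
  power_series (hadamard A (F_coef (nC 2) (nC (N + 1)) (nC (N + 2)))) z
  = (nC (N + 1) * power_series (primitive_coef N A) z)%C.
Proof.
  intros HA Hz.
  rewrite <- power_series_scal by (auto using disk_coefs_primitive).
  apply power_series_ext. intros n. unfold hadamard, primitive_coef.
  rewrite F_coef_two. ring.
Qed.

Lemma shift_coef_mul_INR (N j : nat) (e : nat -> C) (n : nat) :
  (RtoC (INR (n + j)) * shift_coef N e n)%C
  = shift_coef N (fun m => RtoC (INR (m + (N + j))) * e m)%C n.
Proof.
  revert j n. induction N as [|N IH]; intros j n; [reflexivity|].
  destruct n as [|n]; [cbn [shift_coef]; ring|]. cbn [shift_coef].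
  replace (S n + j)%nat with (n + S j)%nat by lia.
  replace (S N + j)%nat with (N + S j)%nat by lia. apply IH.
Qed.

Lemma shift_coef_ext (N : nat) (d e : nat -> C) :
  (forall n, d n = e n) -> forall n, shift_coef N d n = shift_coef N e n.
Proof.
  intros H. induction N as [|N IH]; [exact H|].
  intros [|n]; [reflexivity | apply IH].
Qed.

Lemma deriv_coef_primitive (N : nat) (A : nat -> C) (n : nat) :
  deriv_coef (shift_coef (S N) (primitive_coef N A)) n
  = shift_coef N (fun m => RtoC (INR (S m)) * A m)%C n.
Proof.
  unfold deriv_coef. cbn [shift_coef].
  replace (S n) with (n + 1)%nat by lia. rewrite shift_coef_mul_INR.
  apply shift_coef_ext. intros m. unfold primitive_coef.
  rewrite Cmult_assoc, <- RtoC_mult. do 2 f_equal. field.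
  apply not_0_INR. lia.
Qed.

(** [N] = 0 gives [z F(a,b;a+b;z)], and [N] = [2 k] and [N] = [k] give the
    other two functions that occur in the surface. *)
Definition hadamard_primitive (N : nat) (A : nat -> C) (z : C) : C :=
  power_series (shift_coef (S N) (primitive_coef N A)) z.

Lemma hadamard_primitive_eq (N : nat) (A : nat -> C) (z : C) :
  disk_coefs A -> in_disk z ->
  hadamard_primitive N A z
  = (z ^ (N + 1) / nC (N + 1)
     * power_series (hadamard A (F_coef (nC 2) (nC (N + 1)) (nC (N + 2)))) z)%C.
Proof.
  intros HA Hz. unfold hadamard_primitive.
  rewrite power_series_hadamard_two, power_series_shift
    by (auto using disk_coefs_primitive).
  replace (N + 1)%nat with (S N) by lia. field.
  apply RtoC_INR_neq_0. lia.
Qed.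

Lemma hadamard_primitive_0 (A : nat -> C) (z : C) :
  disk_coefs A -> in_disk z ->
  hadamard_primitive 0 A z = (z * power_series A z)%C.
Proof.
  intros HA Hz. unfold hadamard_primitive.
  rewrite power_series_shift by (auto using disk_coefs_primitive).
  rewrite (power_series_ext _ A).
  - simpl. ring.
  - intros n. unfold primitive_coef. replace (n + (0 + 1))%nat with (S n) by lia.
    rewrite <- (Cmult_1_l (A n)) at 2. do 2 f_equal. field.
    apply not_0_INR. lia.
Qed.

Lemma power_series_deriv_primitive (N : nat) (A : nat -> C) (z : C) :
  disk_coefs A -> in_disk z ->
  power_series (deriv_coef (shift_coef (S N) (primitive_coef N A))) z
  = (z ^ N * power_series (fun n => RtoC (INR (S n)) * A n)%C z)%C.
Proof.
  intros HA Hz.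
  rewrite (power_series_ext _ _ z (deriv_coef_primitive N A)).
  apply power_series_shift; [now apply disk_coefs_mul_S | exact Hz].
Qed.

Lemma deriv_coef_plus (d e : nat -> C) (n : nat) :
  deriv_coef (fun m => d m + e m)%C n = (deriv_coef d n + deriv_coef e n)%C.
Proof. unfold deriv_coef. ring. Qed.

Lemma deriv_coef_scal (a : C) (d : nat -> C) (n : nat) :
  deriv_coef (fun m => a * d m)%C n = (a * deriv_coef d n)%C.
Proof. unfold deriv_coef. ring. Qed.

Definition add_constant (l : C) (d : nat -> C) : nat -> C :=
  fun n => match n with O => (d O + l)%C | S m => d (S m) end.

Lemma disk_coefs_add_constant (l : C) (d : nat -> C) :
  disk_coefs d -> disk_coefs (add_constant l d).
Proof.
  intros Hd r Hr.
  apply (ex_series_incr_1 (K := R_AbsRing) (V := R_NormedModule)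
           (fun n => Cmod (add_constant l d n) * r ^ n)).
  exact (proj1 (ex_series_incr_1 (K := R_AbsRing) (V := R_NormedModule)
           (fun n => Cmod (d n) * r ^ n)) (Hd r Hr)).
Qed.

Lemma power_series_add_constant (l : C) (d : nat -> C) (z : C) :
  disk_coefs d -> in_disk z ->
  power_series (add_constant l d) z = (power_series d z + l)%C.
Proof.
  intros Hd Hz. unfold power_series.
  rewrite (Cseries_incr_1 (fun n => add_constant l d n * z ^ n)%C),
    (Cseries_incr_1 (fun n => d n * z ^ n)%C).
  - simpl. ring.
  - now apply disk_coefs_ex_series.
  - apply disk_coefs_ex_series; [now apply disk_coefs_add_constant | exact Hz].
Qed.

(** With [p = h'] one has [g' = s^2 z^{2k} p], and the derivative of the
    primitive in the third coordinate is [s z^k p].  Hence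
    [phi1 = h' + g'], [phi2 = - i (h' - g')], [phi3 = - 2 i s z^k h'], and
    [phi1^2 + phi2^2 + phi3^2 = 4 h' g' - 4 s^2 z^{2k} h'^2 = 0]. *)
Lemma lift_weierstrass_data (a b alpha s : C) (k : nat) (c : R) :
  (s * s)%C = alpha -> disk_coefs (F_coef a b (a + b)) ->
  let p := power_series (fun n => RtoC (INR (S n)) * F_coef a b (a + b) n)%C in
  weierstrass_data (lift a b alpha s k c)
    (fun z => p z * (1 + s * z ^ k * (s * z ^ k)))%C
    (fun z => - Ci * p z * (1 - s * z ^ k * (s * z ^ k)))%C
    (fun z => - (2) * Ci * s * z ^ k * p z)%C.
Proof.
  intros Hs HA p. set (A := F_coef a b (a + b)) in *.
  set (e := fun N => shift_coef (S N) (primitive_coef N A)).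
  assert (He : forall N, disk_coefs (e N))
    by (intros N; now apply disk_coefs_shift, disk_coefs_primitive).
  assert (Hae : disk_coefs (fun n => alpha * e (2 * k)%nat n)%C)
    by now apply disk_coefs_scal.
  assert (Hme : disk_coefs (fun n => - (1) * (alpha * e (2 * k)%nat n))%C)
    by now apply disk_coefs_scal.
  assert (Hf : forall z, in_disk z -> f_map a b alpha k z
    = (power_series (e O) z + Cconj (alpha * power_series (e (2 * k)%nat) z))%C).
  { intros z Hz. unfold f_map, F. fold A.
    change (power_series (e O) z) with (hadamard_primitive 0 A z).
    change (power_series (e (2 * k)%nat) z)
      with (hadamard_primitive (2 * k) A z).
    rewrite hadamard_primitive_0, hadamard_primitive_eq by assumption.
    do 2 f_equal. unfold Cdiv. ring. }
  exists (fun n => e O n + alpha * e (2 * k)%nat n)%C,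
    (fun n => - Ci * (e O n + - (1) * (alpha * e (2 * k)%nat n)))%C,
    (add_constant (RtoC c) (fun n => - (2) * Ci * s * e k n)%C).
  assert (Hd1 : disk_coefs (fun n => e O n + alpha * e (2 * k)%nat n)%C)
    by now apply disk_coefs_plus.
  assert (Hd2 : disk_coefs
            (fun n => e O n + - (1) * (alpha * e (2 * k)%nat n))%C)
    by now apply disk_coefs_plus.
  assert (Hd3 : disk_coefs (fun n => - (2) * Ci * s * e k n)%C)
    by now apply disk_coefs_scal.
  split; [split; [|split]; split|].
  - exact Hd1.
  - intros z Hz. rewrite power_series_plus, power_series_scal by auto.
    change (Re (f_map a b alpha k z) = Re (power_series (e O) z
              + alpha * power_series (e (2 * k)%nat) z)%C).
    rewrite Hf by exact Hz. reflexivity.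
  - now apply disk_coefs_scal.
  - intros z Hz.
    rewrite power_series_scal, power_series_plus, power_series_scal,
      power_series_scal by auto.
    change (Im (f_map a b alpha k z) = Re (- Ci * (power_series (e O) z
              + - (1) * (alpha * power_series (e (2 * k)%nat) z)))%C).
    rewrite Hf by exact Hz.
    generalize (alpha * power_series (e (2 * k)%nat) z)%C (power_series (e O) z).
    intros [x y] [u v]. simpl. ring.
  - now apply disk_coefs_add_constant.
  - intros z Hz. rewrite power_series_add_constant, power_series_scal by auto.
    change (t_map a b s k c z
            = Re (- (2) * Ci * s * power_series (e k) z + RtoC c)%C).
    unfold t_map. fold A.
    change (power_series (e k) z) with (hadamard_primitive k A z).
    rewrite hadamard_primitive_eq by assumption.
    set (P := power_series _ z).
    replace (- (2) * Ci * s * (z ^ (k + 1) / nC (k + 1) * P))%C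
      with (- (2) * Ci * (s * z ^ (k + 1) / nC (k + 1) * P))%C
      by (unfold Cdiv; ring).
    generalize (s * z ^ (k + 1) / nC (k + 1) * P)%C. intros [x y].
    simpl. ring.
  - intros z Hz.
    assert (Hp : forall N, power_series (deriv_coef (e N)) z = (z ^ N * p z)%C)
      by (intros N; now apply power_series_deriv_primitive).
    assert (Hpow : (alpha * z ^ (2 * k) = s * z ^ k * (s * z ^ k))%C).
    { rewrite <- Hs. replace (2 * k)%nat with (k + k)%nat by lia.
      rewrite Cpow_add_r. ring. }
    assert (Hde : forall N, disk_coefs (deriv_coef (e N)))
      by (intros N; now apply disk_coefs_deriv).
    assert (HCi : (Ci * Ci)%C = (- (1))%C)
      by (unfold Ci, Cmult, Copp, RtoC; simpl; f_equal; ring).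
    split; [|split; [|split]].
    + rewrite (power_series_ext _ (fun n => deriv_coef (e O) n
                 + alpha * deriv_coef (e (2 * k)%nat) n)%C).
      2:{ intros n. now rewrite deriv_coef_plus, deriv_coef_scal. }
      rewrite power_series_plus, power_series_scal, !Hp by
        (auto using disk_coefs_scal).
      rewrite Cmult_assoc, Hpow. simpl. ring.
    + rewrite (power_series_ext _ (fun n => - Ci * (deriv_coef (e O) n
                 + - alpha * deriv_coef (e (2 * k)%nat) n))%C).
      2:{ intros n. unfold deriv_coef. ring. }
      rewrite power_series_scal, power_series_plus, power_series_scal, !Hp by
        (auto using disk_coefs_scal, disk_coefs_plus).
      replace (- alpha * (z ^ (2 * k) * p z))%C
        with (- (alpha * z ^ (2 * k)) * p z)%C by ring.
      rewrite Hpow. simpl. ring.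
    + rewrite (power_series_ext _
                 (fun n => - (2) * Ci * s * deriv_coef (e k) n)%C).
      2:{ intros n. unfold deriv_coef. simpl add_constant. ring. }
      rewrite power_series_scal, Hp by auto. ring.
    + replace (RtoC 0) with ((Ci * Ci + 1)
        * (p z * p z * (1 - s * z ^ k * (s * z ^ k))
           * (1 - s * z ^ k * (s * z ^ k))
           + 4 * (s * z ^ k * (s * z ^ k)) * p z * p z))%C; [ring|].
      rewrite HCi. ring.
Qed.

(** [phi1] and [phi2] determine [p], since [phi1 + i phi2 = 2 p]. *)
Lemma lift_regular (a b alpha s : C) (k : nat) (c : R) (z : C) :
  (s * s)%C = alpha -> disk_coefs (F_coef a b (a + b)) -> in_disk z ->
  power_series (fun n => RtoC (INR (S n)) * F_coef a b (a + b) n)%C z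
    <> RtoC 0 ->
  regular_at (lift a b alpha s k c) z.
Proof.
  intros Hs HA Hz Hp.
  eapply weierstrass_regular;
    [now apply lift_weierstrass_data | exact Hz |]. cbv beta.
  set (P := power_series _ z) in *. set (q := (s * z ^ k)%C).
  destruct (classic ((P * (1 + q * q))%C = RtoC 0)) as [H1|H1]; [|now left].
  right. left. intros H2. apply Hp.
  assert (HCi : (Ci * Ci)%C = (- (1))%C)
    by (unfold Ci, Cmult, Copp, RtoC; simpl; f_equal; ring).
  assert (H3 : (2 * P = P * (1 + q * q) + Ci * (- Ci * P * (1 - q * q)))%C).
  { replace (Ci * (- Ci * P * (1 - q * q)))%C
      with (- (Ci * Ci) * P * (1 - q * q))%C by ring. rewrite HCi. ring. }
  rewrite H1, H2 in H3.
  replace P with (/ 2 * (2 * P))%C.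
  - rewrite H3. ring.
  - field.
Qed.

(** * Zeros of power series with coefficients of small variation *)

Lemma ex_series_of_bounded_sums (u : nat -> R) (M : R) :
  (forall n, 0 <= u n) -> (forall N, sum_n u N <= M) ->
  ex_series u /\ Series u <= M.
Proof.
  intros Hu HM.
  assert (Hex : ex_finite_lim_seq (sum_n u)).
  { apply ex_finite_lim_seq_incr with M; [|exact HM].
    intros n. rewrite sum_Sn. unfold plus. simpl. specialize (Hu (S n)). lra. }
  destruct Hex as [l Hl].
  assert (Hs : is_series u l) by exact Hl.
  split; [now exists l|]. rewrite (is_series_unique u l Hs).
  exact (is_lim_seq_le (sum_n u) (fun _ => M) l M HM Hl (is_lim_seq_const M)).
Qed.

(** The argument of Enestroem and Kakeya: in
    [(1 - z) sum c_n z^n = c_0 + z sum (c_{n+1} - c_n) z^n] the last term has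
    modulus at most [|z|] times the total variation of the coefficients, hence
    less than [|c_0|]. *)
Lemma power_series_neq_0_of_variation (c : nat -> C) (z : C) :
  disk_coefs c -> in_disk z -> c O <> RtoC 0 ->
  (forall N, sum_n (fun n => Cmod (c (S n) - c n)) N <= Cmod (c O)) ->
  power_series c z <> RtoC 0.
Proof.
  intros Hc Hz Hc0 HV H0.
  destruct (ex_series_of_bounded_sums _ _ (fun n => Cmod_ge_0 _) HV)
    as [Hex Hle].
  set (e := fun n => (c (S n) - c n)%C) in *.
  assert (Hew : forall (r : R) (n : nat), 0 <= r <= 1 ->
            0 <= Cmod (e n) * r ^ n <= Cmod (e n)).
  { intros r n Hr. pose proof (Cmod_ge_0 (e n)) as Hp.
    assert (Hrn : 0 <= r ^ n <= 1).
    { split; [apply pow_le; lra|]. rewrite <- (pow1 n). now apply pow_incr. }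
    split; [now apply Rmult_le_pos|]. nra. }
  assert (He : disk_coefs e).
  { intros r Hr.
    apply (ex_series_le (K := R_AbsRing) (V := R_CompleteNormedModule))
      with (2 := Hex).
    intros n. change (Rabs (Cmod (e n) * r ^ n) <= Cmod (e n)).
    rewrite Rabs_pos_eq; apply Hew; lra. }
  assert (Heq : power_series c z
                = (z * (power_series e z + power_series c z) + c O)%C).
  { rewrite <- power_series_plus by assumption.
    assert (Hec : disk_coefs (fun n => e n + c n)%C)
      by now apply disk_coefs_plus.
    replace (z * power_series (fun n => e n + c n)%C z)%C
      with (z ^ 1 * power_series (fun n => e n + c n)%C z)%C by ring.
    rewrite <- power_series_shift by assumption.
    rewrite <- power_series_add_constant
      by (try apply disk_coefs_shift; assumption).
    apply power_series_ext. intros [|n]; unfold e; simpl; ring. }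
  rewrite H0 in Heq.
  assert (Hb : Cmod (power_series e z) <= Cmod (c O)).
  { eapply Rle_trans; [now apply Cmod_Cseries_le, disk_coefs_ex_series|].
    eapply Rle_trans; [|exact Hle]. apply Series_le; [|exact Hex].
    intros n. rewrite Cmod_mult, Cmod_pow. apply Hew.
    split; [apply Cmod_ge_0 | apply Rlt_le, Hz]. }
  assert (Hc1 : c O = (- (z * power_series e z))%C).
  { replace (c O) with (z * (power_series e z + 0) + c O
                        - z * power_series e z)%C by ring.
    rewrite <- Heq. ring. }
  apply Cmod_gt_0 in Hc0. pose proof (Cmod_ge_0 z) as Hz0.
  assert (Hm : Cmod (c O) = Cmod z * Cmod (power_series e z))
    by (rewrite Hc1 at 1; now rewrite Cmod_opp, Cmod_mult).
  unfold in_disk in Hz. nra.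
Qed.

Lemma sum_n_telescope (u : nat -> R) (N : nat) :
  sum_n (fun n => u (S n) - u n) N = u (S N) - u O.
Proof.
  induction N as [|N IH].
  - now rewrite sum_O.
  - rewrite sum_Sn, IH. unfold plus. simpl. ring.
Qed.

Lemma power_series_neq_0_decreasing (c : nat -> R) (z : C) :
  disk_coefs (fun n => RtoC (c n)) -> in_disk z ->
  (forall n, 0 < c n) -> (forall n, c (S n) <= c n) ->
  power_series (fun n => RtoC (c n)) z <> RtoC 0.
Proof.
  intros Hc Hz Hpos Hdec.
  apply power_series_neq_0_of_variation; [exact Hc|exact Hz| |].
  - specialize (Hpos O). intros H. injection H. lra.
  - intros N. rewrite (sum_n_ext _ (fun n => - c (S n) - - c n)).
    + rewrite (sum_n_telescope (fun n => - c n)).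
      pose proof (Hpos O) as H0. specialize (Hpos (S N)).
      rewrite Cmod_R, Rabs_pos_eq; lra.
    + intros n. rewrite <- RtoC_minus, Cmod_R. specialize (Hdec n).
      rewrite Rabs_left1; lra.
Qed.

(** The total variation of an increasing sequence is its limit minus [c O],
    so the bound [2 * c O] is what makes it at most [c O]. *)
Lemma power_series_neq_0_increasing (c : nat -> R) (z : C) :
  disk_coefs (fun n => RtoC (c n)) -> in_disk z ->
  0 < c O -> (forall n, c n <= c (S n)) -> (forall n, c n <= 2 * c O) ->
  power_series (fun n => RtoC (c n)) z <> RtoC 0.
Proof.
  intros Hc Hz Hpos Hinc Hle.
  apply power_series_neq_0_of_variation; [exact Hc|exact Hz| |].
  - intros H. injection H. lra.
  - intros N. rewrite (sum_n_ext _ (fun n => c (S n) - c n)).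
    + rewrite (sum_n_telescope c). specialize (Hle (S N)).
      rewrite Cmod_R, Rabs_pos_eq; lra.
    + intros n. rewrite <- RtoC_minus, Cmod_R. specialize (Hinc n).
      apply Rabs_pos_eq. lra.
Qed.

(** * Improper integrals over the positive half-line *)

Notation is_RInt_half f l :=
  (is_RInt_gen f (at_right 0) (Rbar_locally p_infty) l).

Lemma filter_prod_half (a0 b0 : R) (P : R * R -> Prop) :
  0 < a0 ->
  (forall a b, 0 < a < a0 -> b0 < b -> P (a, b)) ->
  filter_prod (at_right 0) (Rbar_locally p_infty) P.
Proof.
  intros Ha0 HP.
  apply Filter_prod with (fun a => 0 < a < a0) (fun b => b0 < b).
  - exists (mkposreal _ Ha0). intros a Ha Hpos. split; [exact Hpos|].
    change (Rabs (a - 0) < a0) in Ha. apply Rabs_lt_between in Ha. lra.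
  - now exists b0.
  - intros a b Ha Hb. now apply HP.
Qed.

Lemma filter_prod_half_pos (P : R * R -> Prop) :
  (forall a b, 0 < a < b -> P (a, b)) ->
  filter_prod (at_right 0) (Rbar_locally p_infty) P.
Proof.
  intros HP. apply filter_prod_half with 1 1; [lra|].
  intros a b Ha Hb. apply HP. lra.
Qed.

Lemma ex_RInt_continuous_pos (f : R -> R) (a b : R) :
  (forall t, 0 < t -> continuous f t) -> 0 < a -> a <= b -> ex_RInt f a b.
Proof.
  intros Hf Ha Hab. apply (ex_RInt_continuous (V := R_CompleteNormedModule)).
  intros t Ht. rewrite Rmin_left in Ht by exact Hab. apply Hf. lra.
Qed.

(** The value is the supremum of the integrals over compact intervals, to which
    they increase because [f] is nonnegative. *)
Lemma is_RInt_half_nonneg (f : R -> R) (M : R) :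
  (forall t, 0 < t -> continuous f t) -> (forall t, 0 < t -> 0 <= f t) ->
  (forall a b, 0 < a <= b -> RInt f a b <= M) ->
  exists l, is_RInt_half f l /\ forall a b, 0 < a <= b -> RInt f a b <= l.
Proof.
  intros Hc Hpos HM.
  destruct (completeness (fun v => exists a b, 0 < a <= b /\ v = RInt f a b))
    as [l [Hub Hlub]].
  - exists M. intros v (a & b & Hab & ->). now apply HM.
  - exists (RInt f 1 1), 1, 1. split; [lra | reflexivity].
  - assert (Hle : forall a b, 0 < a <= b -> RInt f a b <= l)
      by (intros a b Hab; apply Hub; now exists a, b).
    exists l. split; [|exact Hle].
    intros P [eps HP]. pose proof (cond_pos eps) as Heps.
    assert (Hex : exists a0 b0, 0 < a0 <= b0 /\ l - eps < RInt f a0 b0).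
    { apply NNPP. intros Hn. assert (l <= l - eps); [|lra].
      apply Hlub. intros v (a & b & Hab & ->). apply Rnot_lt_le. intros Hlt.
      apply Hn. now exists a, b. }
    destruct Hex as (a0 & b0 & Hab0 & Hl0).
    apply filter_prod_half with a0 b0; [lra|]. intros a b Ha Hb.
    assert (HI : forall u v, 0 < u -> u <= v -> ex_RInt f u v)
      by (intros u v; now apply ex_RInt_continuous_pos).
    assert (Hge : forall u v, 0 < u -> u <= v -> 0 <= RInt f u v).
    { intros u v Hu Huv. apply RInt_ge_0; [exact Huv | now apply HI |].
      intros t Ht. apply Hpos. lra. }
    exists (RInt f a b). split.
    + apply (RInt_correct (V := R_CompleteNormedModule)). apply HI; simpl; lra.
    + apply HP. change (Rabs (RInt f a b - l) < eps).
      assert (H1 : RInt f a a0 + RInt f a0 b0 = RInt f a b0)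
        by (apply (RInt_Chasles (V := R_CompleteNormedModule)); apply HI; lra).
      assert (H2 : RInt f a b0 + RInt f b0 b = RInt f a b)
        by (apply (RInt_Chasles (V := R_CompleteNormedModule)); apply HI; lra).
      assert (H3 := Hge a a0 ltac:(lra) ltac:(lra)).
      assert (H4 := Hge b0 b ltac:(lra) ltac:(lra)).
      assert (H5 := Hle a b ltac:(lra)).
      apply Rabs_lt_between. lra.
Qed.

Lemma is_RInt_half_plus (f g : R -> R) (lf lg : R) :
  is_RInt_half f lf -> is_RInt_half g lg ->
  is_RInt_half (fun t => f t + g t) (lf + lg).
Proof. intros Hf Hg. exact (is_RInt_gen_plus f g lf lg Hf Hg). Qed.

Lemma is_RInt_half_scal (k : R) (f : R -> R) (l : R) :
  is_RInt_half f l -> is_RInt_half (fun t => k * f t) (k * l).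
Proof. intros Hf. exact (is_RInt_gen_scal f k l Hf). Qed.

Lemma is_RInt_half_ext (f g : R -> R) (l : R) :
  (forall t, 0 < t -> f t = g t) -> is_RInt_half f l -> is_RInt_half g l.
Proof.
  intros Hfg. apply is_RInt_gen_ext. apply filter_prod_half_pos.
  intros a b Hab t Ht. simpl in Ht. rewrite Rmin_left in Ht by lra.
  apply Hfg. lra.
Qed.

Lemma is_RInt_half_unique (f : R -> R) (l l' : R) :
  is_RInt_half f l -> is_RInt_half f l' -> l = l'.
Proof.
  intros H H'. rewrite <- (is_RInt_gen_unique f l H).
  now apply (is_RInt_gen_unique f l').
Qed.

Lemma is_RInt_half_ge_0 (f : R -> R) (l : R) :
  (forall t, 0 < t -> 0 <= f t) -> is_RInt_half f l -> 0 <= l.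
Proof.
  intros Hf Hl. apply Rle_trans with (norm l); [apply norm_ge_0|].
  apply (RInt_gen_norm (V := R_CompleteNormedModule) (Fa := at_right 0)
           (Fb := Rbar_locally p_infty) f f l l); try assumption.
  - apply filter_prod_half_pos. intros a b Hab. simpl. lra.
  - apply filter_prod_half_pos. intros a b Hab t Ht. simpl in Ht.
    apply Req_le, Rabs_pos_eq, Hf. lra.
Qed.

(** Comparison test: [f + w] and [w] are nonnegative with bounded integrals. *)
Lemma is_RInt_half_dominated (f w : R -> R) (M : R) :
  (forall t, 0 < t -> continuous f t) -> (forall t, 0 < t -> continuous w t) ->
  (forall t, 0 < t -> Rabs (f t) <= w t) ->
  (forall a b, 0 < a <= b -> RInt w a b <= M) ->
  exists l, is_RInt_half f l.
Proof.
  intros Hf Hw Hfw HM.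
  assert (Hw0 : forall t, 0 < t -> 0 <= w t).
  { intros t Ht. apply Rle_trans with (2 := Hfw t Ht). apply Rabs_pos. }
  assert (Hfwc : forall t, 0 < t -> continuous (fun t => f t + w t) t).
  { intros t Ht. now apply (continuous_plus (V := R_NormedModule)); auto. }
  destruct (is_RInt_half_nonneg w M Hw Hw0 HM) as [lw [Hlw _]].
  destruct (is_RInt_half_nonneg (fun t => f t + w t) (2 * M)) as [l [Hl _]].
  - exact Hfwc.
  - intros t Ht. specialize (Hfw t Ht). apply Rabs_le_between in Hfw. lra.
  - intros a b Hab. apply Rle_trans with (RInt (fun t => scal 2 (w t)) a b).
    + apply RInt_le.
      * lra.
      * apply ex_RInt_continuous_pos; [exact Hfwc | lra | lra].
      * apply (ex_RInt_scal (V := R_NormedModule)).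
        apply ex_RInt_continuous_pos; [exact Hw | lra | lra].
      * intros t Ht. assert (H := Hfw t ltac:(lra)).
        apply Rabs_le_between in H. change (f t + w t <= 2 * w t). lra.
    + rewrite (RInt_scal (V := R_CompleteNormedModule))
        by (apply ex_RInt_continuous_pos; [exact Hw | lra | lra]).
      specialize (HM a b Hab). change (2 * RInt w a b <= 2 * M). lra.
  - exists (l + -1 * lw).
    apply is_RInt_half_ext with (fun t => (f t + w t) + -1 * w t).
    + intros t _. ring.
    + apply is_RInt_half_plus; [exact Hl|]. now apply is_RInt_half_scal.
Qed.

Lemma is_RInt_half_pair (f g : R -> R) (lf lg : R) :
  is_RInt_half f lf -> is_RInt_half g lg ->
  is_RInt_gen (V := C_R_NormedModule) (fun t => (f t, g t))
    (at_right 0) (Rbar_locally p_infty) (lf, lg).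
Proof.
  intros Hf Hg P [eps HP].
  assert (Bf := Hf (fun y => ball lf eps y) (locally_ball lf eps)).
  assert (Bg := Hg (fun y => ball lg eps y) (locally_ball lg eps)).
  unfold filtermapi in *. generalize (filter_and _ _ Bf Bg). apply filter_imp.
  intros [a b] [(y1 & I1 & B1) (y2 & I2 & B2)].
  exists (y1, y2). split.
  - now apply (is_RInt_fct_extend_pair (U := R_NormedModule)
                 (V := R_NormedModule)).
  - apply HP. now split.
Qed.

Lemma is_RInt_half_derive (U U' : R -> R) (la lb l : R) :
  (forall t, 0 < t -> is_derive U t (U' t)) ->
  (forall t, 0 < t -> continuous U' t) ->
  filterlim U (at_right 0) (locally la) ->
  filterlim U (Rbar_locally p_infty) (locally lb) ->
  lb - la = l -> is_RInt_half U' l.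
Proof.
  intros HU HU' Ha Hb <-.
  apply is_RInt_half_ext with (Derive U).
  { intros t Ht. apply is_derive_unique. now apply HU. }
  apply is_RInt_gen_Derive; try assumption; apply filter_prod_half_pos;
    intros a b Hab t Ht; simpl in Ht; rewrite Rmin_left in Ht by lra.
  - exists (U' t). apply HU. lra.
  - apply continuous_ext_loc with U'; [|apply HU'; lra].
    assert (Ht0 : 0 < t) by lra. exists (mkposreal t Ht0). intros v Hv.
    symmetry. apply is_derive_unique, HU.
    change (Rabs (v - t) < t) in Hv. apply Rabs_lt_between in Hv. lra.
Qed.

(** * The gamma function *)

Lemma exp_le_compat (x y : R) : x <= y -> exp x <= exp y.
Proof.
  intros [H|H]; [now apply Rlt_le, exp_increasing | rewrite H; apply Rle_refl].
Qed.

Definition gamma_density (x t : R) : R := Rpower t (x - 1) * exp (- t).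

Lemma gamma_density_pos (x t : R) : 0 < gamma_density x t.
Proof. apply Rmult_lt_0_compat; apply exp_pos. Qed.

Lemma gamma_density_plus (x y t : R) :
  gamma_density (x + y) t = Rpower t y * gamma_density x t.
Proof.
  unfold gamma_density. replace (x + y - 1) with (y + (x - 1)) by ring.
  rewrite Rpower_plus. ring.
Qed.

Lemma gamma_density_continuous (x t : R) :
  0 < t -> continuous (gamma_density x) t.
Proof.
  intros Ht. apply (ex_derive_continuous (V := R_NormedModule)).
  unfold gamma_density, Rpower. auto_derive. exact Ht.
Qed.

(** The maximum of [y ln(1+t) - t] is attained at [1 + t = y], where its value
    is [y ln y - (y - 1) <= y ln y]. *)
Lemma exp_opp_le (y t : R) :
  1 <= y -> 0 < t -> exp (- t) <= exp (y * ln y) * exp (- (y * ln (1 + t))).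
Proof.
  intros Hy Ht. rewrite <- exp_plus. apply exp_le_compat.
  assert (H := exp_ineq1_le (ln ((1 + t) / y))).
  rewrite exp_ln in H by (apply Rdiv_lt_0_compat; lra).
  rewrite ln_div in H by lra.
  apply Rmult_le_compat_r with (r := y) in H; [|lra].
  replace ((1 + t) / y * y) with (1 + t) in H by (field; lra). lra.
Qed.

(** [t^{x-1} e^{-t}] is dominated by a constant times [t^{x-1} (1+t)^{-x-1}],
    the derivative of [(t/(1+t))^x / x], which is bounded. *)
Lemma RInt_gamma_density_le (x : R) :
  0 < x ->
  exists M, forall a b, 0 < a <= b -> RInt (gamma_density x) a b <= M.
Proof.
  intros Hx. set (K := exp ((x + 1) * ln (x + 1))).
  set (Phi := fun t => K / x * exp (x * ln (t / (1 + t)))).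
  set (phi := fun t => K * exp (x * ln (t / (1 + t))) / (t * (1 + t))).
  assert (HK : 0 < K) by apply exp_pos.
  assert (HKx : 0 < K / x) by now apply Rdiv_lt_0_compat.
  exists (K / x). intros a b Hab.
  assert (HPhi : forall t, 0 < t -> is_derive Phi t (phi t)).
  { intros t Ht. unfold Phi, phi. auto_derive.
    - split; [lra|]. split; [apply Rdiv_lt_0_compat; lra | exact I].
    - unfold Rdiv. field. repeat split; lra. }
  assert (Hphi : forall t, 0 < t -> continuous phi t).
  { intros t Ht. apply (ex_derive_continuous (V := R_NormedModule)).
    unfold phi. auto_derive. repeat split.
    - lra.
    - apply Rdiv_lt_0_compat; lra.
    - apply Rgt_not_eq, Rmult_lt_0_compat; lra. }
  assert (HI : is_RInt phi a b (Phi b - Phi a)).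
  { apply (is_RInt_derive (V := R_CompleteNormedModule) Phi phi); intros t Ht;
      rewrite Rmin_left in Ht by lra; [apply HPhi | apply Hphi]; lra. }
  apply Rle_trans with (RInt phi a b).
  - apply RInt_le.
    + lra.
    + apply ex_RInt_continuous_pos; try lra. apply gamma_density_continuous.
    + now exists (Phi b - Phi a).
    + intros t Ht. assert (Ht0 : 0 < t) by lra.
      assert (H := exp_opp_le (x + 1) t ltac:(lra) Ht0). fold K in H.
      unfold gamma_density, phi, Rpower.
      assert (Ht1 : ln (t / (1 + t)) = ln t - ln (1 + t))
        by (apply ln_div; lra).
      rewrite Ht1.
      replace (K * exp (x * (ln t - ln (1 + t))) / (t * (1 + t)))
        with (exp ((x - 1) * ln t) * (K * exp (- ((x + 1) * ln (1 + t))))).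
      * apply Rmult_le_compat_l; [apply Rlt_le, exp_pos | exact H].
      * replace ((x - 1) * ln t) with (x * ln t + - ln t) by ring.
        replace (x * (ln t - ln (1 + t)))
          with (x * ln t + - (x * ln (1 + t))) by ring.
        replace (- ((x + 1) * ln (1 + t)))
          with (- (x * ln (1 + t)) + - ln (1 + t)) by ring.
        rewrite !exp_plus, !(exp_Ropp (ln _)), !exp_ln by lra.
        field. lra.
  - rewrite (is_RInt_unique _ _ _ _ HI).
    assert (Ha : 0 <= Phi a)
      by (apply Rlt_le, Rmult_lt_0_compat; [exact HKx | apply exp_pos]).
    assert (Hb : Phi b <= K / x * 1); [|lra].
    apply Rmult_le_compat_l; [lra|].
    apply Rle_trans with (exp 0); [apply exp_le_compat | rewrite exp_0; lra].
    assert (Hln : ln (b / (1 + b)) < 0); [|nra].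
    rewrite <- ln_1. apply ln_increasing; [apply Rdiv_lt_0_compat; lra|].
    apply Rmult_lt_reg_r with (1 + b); [lra|].
    replace (b / (1 + b) * (1 + b)) with b by (field; lra). lra.
Qed.

Definition RGamma (x : R) : R :=
  RInt_gen (gamma_density x) (at_right 0) (Rbar_locally p_infty).

Lemma is_RInt_RGamma (x : R) :
  0 < x -> is_RInt_half (gamma_density x) (RGamma x) /\ 0 < RGamma x.
Proof.
  intros Hx. destruct (RInt_gamma_density_le x Hx) as [M HM].
  destruct (is_RInt_half_nonneg (gamma_density x) M) as (l & Hl & Hle).
  - apply gamma_density_continuous.
  - intros t _. apply Rlt_le, gamma_density_pos.
  - exact HM.
  - assert (El : RGamma x = l) by now apply is_RInt_gen_unique.
    rewrite El. split; [exact Hl|].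
    apply Rlt_le_trans with (2 := Hle 1 2 ltac:(lra)).
    apply RInt_gt_0; [lra | | ].
    + intros t _. apply gamma_density_pos.
    + intros t Ht. apply gamma_density_continuous. lra.
Qed.

(** The real and the imaginary part of Euler's integrand at [x + i y] are the
    density at [x] times the cosine and the sine of [y ln t]. *)
Lemma is_RInt_half_gamma_trig (T : R -> R) (x y : R) :
  (forall u, continuous T u) -> (forall u, Rabs (T u) <= 1) -> 0 < x ->
  exists l, is_RInt_half (fun t => gamma_density x t * T (y * ln t)) l.
Proof.
  intros HT HT1 Hx. destruct (RInt_gamma_density_le x Hx) as [M HM].
  apply is_RInt_half_dominated with (gamma_density x) M.
  - intros t Ht. apply (continuous_mult (K := R_AbsRing)).
    + now apply gamma_density_continuous.
    + apply (continuous_comp (fun t => y * ln t) T); [|apply HT].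
      apply (ex_derive_continuous (V := R_NormedModule)).
      auto_derive. exact Ht.
  - apply gamma_density_continuous.
  - intros t Ht. pose proof (gamma_density_pos x t) as Hp.
    rewrite Rabs_mult, (Rabs_pos_eq (gamma_density x t)) by lra.
    specialize (HT1 (y * ln t)). nra.
  - exact HM.
Qed.

Lemma Rabs_cos_le (u : R) : Rabs (cos u) <= 1.
Proof. apply Rabs_le. pose proof (COS_bound u). lra. Qed.

Lemma Rabs_sin_le (u : R) : Rabs (sin u) <= 1.
Proof. apply Rabs_le. pose proof (SIN_bound u). lra. Qed.

Lemma is_RInt_Gamma_parts (z : C) :
  0 < Re z ->
  is_RInt_half (fun t => gamma_density (Re z) t * cos (Im z * ln t))
    (Re (Gamma z)) /\
  is_RInt_half (fun t => gamma_density (Re z) t * sin (Im z * ln t))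
    (Im (Gamma z)) /\
  Cmod (Gamma z) <= RGamma (Re z).
Proof.
  intros Hz. set (x := Re z) in *. set (y := Im z).
  destruct (is_RInt_half_gamma_trig cos x y) as [l1 H1];
    [apply continuous_cos | apply Rabs_cos_le | exact Hz |].
  destruct (is_RInt_half_gamma_trig sin x y) as [l2 H2];
    [apply continuous_sin | apply Rabs_sin_le | exact Hz |].
  assert (HG := is_RInt_half_pair _ _ _ _ H1 H2).
  assert (HG' : is_RInt_gen (V := C_R_NormedModule)
            (fun t : R => (Rcpower t (z - RtoC 1) * RtoC (exp (- t)))%C)
            (at_right 0) (Rbar_locally p_infty) (l1, l2)).
  { revert HG. apply (is_RInt_gen_ext (V := C_R_NormedModule)).
    apply filter_prod_half_pos. intros a b Hab t _.
    unfold gamma_density, Rcpower, Cmult, RtoC, x, y.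
    destruct z as [x' y']. simpl.
    replace (x' + - (1)) with (x' - 1) by ring.
    replace (y' + - 0) with y' by ring. f_equal; ring. }
  assert (HE : Gamma z = (l1, l2))
    by exact (is_RInt_gen_unique (V := C_R_CompleteNormedModule) _ _ HG').
  rewrite HE. split; [exact H1|]. split; [exact H2|].
  assert (HN : forall u v : R,
             norm (K := R_AbsRing) (V := C_R_NormedModule) (u, v)
             = Cmod (u, v)).
  { intros u v. unfold norm. simpl. unfold prod_norm, norm. simpl.
    unfold Cmod. simpl. unfold abs. simpl.
    f_equal. rewrite !Rmult_1_r.
    rewrite <- !Rabs_mult, !Rabs_pos_eq by nra. reflexivity. }
  rewrite <- HN.
  apply (RInt_gen_norm (V := C_R_CompleteNormedModule) (Fa := at_right 0)
           (Fb := Rbar_locally p_infty) _ (gamma_density x) _ _)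
    with (3 := HG).
  - apply filter_prod_half_pos. intros a b Hab. simpl. lra.
  - apply filter_prod_half_pos. intros a b Hab t Ht.
    apply Req_le.
    etransitivity; [apply HN|]. unfold Cmod. simpl.
    pose proof (gamma_density_pos x t) as Hp.
    rewrite <- (sqrt_Rsqr (gamma_density x t)) at 5 by lra. f_equal.
    pose proof (sin2_cos2 (y * ln t)) as Hsc. unfold Rsqr in *. nra.
  - now apply is_RInt_RGamma.
Qed.

Lemma gamma_density_succ (x t : R) :
  0 < t -> gamma_density (x + 1) t = t * gamma_density x t.
Proof. intros Ht. now rewrite gamma_density_plus, Rpower_1. Qed.

Lemma gamma_density_at_0 (x eps : R) :
  0 < x -> 0 < eps ->
  exists delta, 0 < delta /\
    forall t, 0 < t < delta -> gamma_density (x + 1) t < eps.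
Proof.
  intros Hx Heps. exists (exp (ln eps / x)). split; [apply exp_pos|].
  intros t Ht. unfold gamma_density, Rpower.
  replace (x + 1 - 1) with x by ring. rewrite <- exp_plus.
  rewrite <- (exp_ln eps) at 1 by exact Heps. apply exp_increasing.
  assert (H : ln t < ln eps / x)
    by (rewrite <- (ln_exp (ln eps / x)); apply ln_increasing; lra).
  apply Rmult_lt_compat_l with (r := x) in H; [|exact Hx].
  replace (x * (ln eps / x)) with (ln eps) in H by (field; lra). lra.
Qed.

Lemma gamma_density_at_infinity (x eps : R) :
  0 < x -> 0 < eps ->
  exists B, 0 < B /\ forall t, B < t -> gamma_density (x + 1) t < eps.
Proof.
  intros Hx Heps. set (K := exp ((x + 1) * ln (x + 1))).
  assert (HK : 0 < K) by apply exp_pos.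
  assert (HB : 0 < K / eps) by now apply Rdiv_lt_0_compat.
  exists (K / eps). split; [exact HB|]. intros t Ht.
  assert (Ht0 : 0 < t) by lra.
  apply Rle_lt_trans with (K / (1 + t)).
  - unfold gamma_density, Rpower. replace (x + 1 - 1) with x by ring.
    assert (H := exp_opp_le (x + 1) t ltac:(lra) Ht0). fold K in H.
    apply Rle_trans
      with (exp (x * ln t) * (K * exp (- ((x + 1) * ln (1 + t))))).
    + apply Rmult_le_compat_l; [apply Rlt_le, exp_pos | exact H].
    + replace (K / (1 + t)) with (K * exp (- ln (1 + t)))
        by (rewrite exp_Ropp, exp_ln by lra; reflexivity).
      replace (exp (x * ln t) * (K * exp (- ((x + 1) * ln (1 + t)))))
        with (K * (exp (x * ln t) * exp (- ((x + 1) * ln (1 + t))))) by ring.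
      apply Rmult_le_compat_l; [lra|]. rewrite <- exp_plus.
      apply exp_le_compat.
      assert (ln t <= ln (1 + t)) by (apply ln_le; lra). nra.
  - apply Rmult_lt_reg_r with (1 + t); [lra|].
    replace (K / (1 + t) * (1 + t)) with K by (field; lra).
    replace K with (eps * (K / eps)) by (field; lra).
    apply Rmult_lt_compat_l; lra.
Qed.

(** Integration by parts against [T], a cosine or a sine: the function
    [t^x e^{-t} T (y ln t)] tends to 0 at both ends. *)
Lemma is_RInt_half_gamma_parts (T T' : R -> R) (x y : R) :
  (forall u, is_derive T u (T' u)) -> (forall u, continuous T' u) ->
  (forall u, Rabs (T u) <= 1) -> 0 < x ->
  is_RInt_half
    (fun t => x * (gamma_density x t * T (y * ln t))
              + (y * (gamma_density x t * T' (y * ln t))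
                 + -1 * (gamma_density (x + 1) t * T (y * ln t)))) 0.
Proof.
  intros HT HT' HT1 Hx.
  set (U := fun t => gamma_density (x + 1) t * T (y * ln t)).
  assert (HU : forall t, Rabs (U t) <= gamma_density (x + 1) t).
  { intros t. unfold U. pose proof (gamma_density_pos (x + 1) t) as Hp.
    rewrite Rabs_mult, (Rabs_pos_eq (gamma_density _ t)) by lra.
    specialize (HT1 (y * ln t)). nra. }
  apply is_RInt_half_derive with U 0 0; [| | | | ring].
  - intros t Ht.
    assert (Hg : is_derive (gamma_density (x + 1)) t
                   (x * gamma_density x t - gamma_density (x + 1) t)).
    { rewrite gamma_density_succ by exact Ht.
      unfold gamma_density, Rpower. auto_derive; [exact Ht|].
      replace ((x + 1 - 1) * ln t) with ((x - 1) * ln t + ln t) by ring.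
      rewrite exp_plus, exp_ln by exact Ht. field. lra. }
    assert (Hc : is_derive (fun t => T (y * ln t)) t (y / t * T' (y * ln t))).
    { apply (is_derive_comp (K := R_AbsRing) (V := R_NormedModule) T
               (fun t => y * ln t)); [apply HT|].
      auto_derive; [exact Ht|]. field. lra. }
    assert (H := is_derive_mult (K := R_AbsRing) _ _ t _ _ Hg Hc Rmult_comm).
    unfold U. revert H. unfold mult, plus. simpl.
    match goal with |- is_derive _ _ ?l -> is_derive _ _ ?l' =>
      replace l with l'; [easy|] end.
    rewrite gamma_density_succ by exact Ht. field. lra.
  - intros t Ht.
    assert (HTc : forall (V : R -> R), (forall u, continuous V u) ->
              continuous (fun t => V (y * ln t)) t).
    { intros V HV. apply (continuous_comp (fun t => y * ln t) V); [|apply HV].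
      apply (ex_derive_continuous (V := R_NormedModule)).
      auto_derive. exact Ht. }
    assert (HgT : forall (v : R) (V : R -> R) (l : R),
              (forall u, continuous V u) ->
              continuous (fun t => l * (gamma_density v t * V (y * ln t))) t).
    { intros v V l HV. apply (continuous_mult (K := R_AbsRing));
        [apply continuous_const|].
      apply (continuous_mult (K := R_AbsRing));
        [now apply gamma_density_continuous | now apply HTc]. }
    assert (HTct : forall u, continuous T u).
    { intros u. apply (ex_derive_continuous (V := R_NormedModule)).
      eexists. apply HT. }
    apply (continuous_plus (V := R_NormedModule)); [now apply HgT|].
    apply (continuous_plus (V := R_NormedModule)); now apply HgT.
  - apply filterlim_locally. intros eps.
    destruct (gamma_density_at_0 x eps Hx (cond_pos eps)) as (d & Hd & H).
    exists (mkposreal d Hd). intros t Ht Ht0.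
    change (Rabs (t - 0) < d) in Ht. apply Rabs_lt_between in Ht.
    change (Rabs (U t - 0) < eps). rewrite Rminus_0_r.
    eapply Rle_lt_trans; [apply HU | apply H; lra].
  - apply filterlim_locally. intros eps.
    destruct (gamma_density_at_infinity x eps Hx (cond_pos eps))
      as (B & HB & H).
    exists B. intros t Ht.
    change (Rabs (U t - 0) < eps). rewrite Rminus_0_r.
    eapply Rle_lt_trans; [apply HU | now apply H].
Qed.

(** The two integrations by parts, against the cosine and the sine, are the real
    and the imaginary part of this identity. *)
Lemma Gamma_succ (z : C) :
  0 < Re z -> Gamma (z + RtoC 1) = (z * Gamma z)%C.
Proof.
  intros Hz.
  destruct (is_RInt_Gamma_parts z Hz) as (Hr & Hi & _).
  assert (Hz1 : 0 < Re (z + RtoC 1)%C)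
    by (unfold Re in *; simpl; lra).
  destruct (is_RInt_Gamma_parts _ Hz1) as (Hr1 & Hi1 & _).
  assert (Ex : Re (z + RtoC 1)%C = Re z + 1) by reflexivity.
  assert (Ey : Im (z + RtoC 1)%C = Im z)
    by (change (Im z + 0 = Im z); ring).
  rewrite Ex, Ey in Hr1, Hi1.
  assert (Pc := is_RInt_half_gamma_parts cos (fun u => - sin u) (Re z) (Im z)
                  is_derive_cos
                  (fun u => continuous_opp (V := R_NormedModule) sin u
                              (continuous_sin u))
                  Rabs_cos_le Hz).
  assert (Ps := is_RInt_half_gamma_parts sin cos (Re z) (Im z)
                  is_derive_sin continuous_cos Rabs_sin_le Hz).
  set (z1 := (z + RtoC 1)%C) in *.
  assert (Er : Re z * Re (Gamma z)
               + (- Im z * Im (Gamma z) + -1 * Re (Gamma z1)) = 0).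
  { apply is_RInt_half_unique with (2 := Pc).
    apply is_RInt_half_ext with
      (fun t => Re z * (gamma_density (Re z) t * cos (Im z * ln t))
        + (- Im z * (gamma_density (Re z) t * sin (Im z * ln t))
           + -1 * (gamma_density (Re z + 1) t * cos (Im z * ln t))));
      [intros t _; ring|].
    exact (is_RInt_half_plus _ _ _ _ (is_RInt_half_scal _ _ _ Hr)
             (is_RInt_half_plus _ _ _ _ (is_RInt_half_scal _ _ _ Hi)
                (is_RInt_half_scal _ _ _ Hr1))). }
  assert (Ei : Re z * Im (Gamma z)
               + (Im z * Re (Gamma z) + -1 * Im (Gamma z1)) = 0).
  { apply is_RInt_half_unique with (2 := Ps).
    exact (is_RInt_half_plus _ _ _ _ (is_RInt_half_scal _ _ _ Hi)
             (is_RInt_half_plus _ _ _ _ (is_RInt_half_scal _ _ _ Hr)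
                (is_RInt_half_scal _ _ _ Hi1))). }
  clearbody z1. clear - Er Ei.
  destruct z as [x y], (Gamma (x, y)) as [g1 g2], (Gamma z1) as [h1 h2].
  unfold Cmult. simpl in *. f_equal; lra.
Qed.

Lemma Gamma_shifted_factorial (z : C) (n : nat) :
  0 < Re z ->
  Gamma (z + RtoC (INR n)) = (shifted_factorial z n * Gamma z)%C.
Proof.
  intros Hz. induction n as [|n IH].
  - replace (z + RtoC (INR 0))%C with z by (simpl; ring). simpl. ring.
  - replace (z + RtoC (INR (S n)))%C with ((z + RtoC (INR n)) + RtoC 1)%C
      by (rewrite S_INR, RtoC_plus; ring).
    rewrite Gamma_succ.
    + rewrite IH. cbn [shifted_factorial]. ring.
    + pose proof (pos_INR n) as Hn. unfold Re in *. simpl. lra.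
Qed.

Lemma Gamma_RtoC (x : R) : 0 < x -> Gamma (RtoC x) = RtoC (RGamma x).
Proof.
  intros Hx.
  destruct (is_RInt_Gamma_parts (RtoC x) Hx) as (Hr & Hi & _).
  destruct (is_RInt_RGamma x Hx) as [HG _].
  change (Re (RtoC x)) with x in *. change (Im (RtoC x)) with 0 in *.
  apply injective_projections.
  - apply is_RInt_half_unique with (1 := Hr).
    revert HG. apply is_RInt_half_ext. intros t _.
    rewrite Rmult_0_l, cos_0. ring.
  - apply is_RInt_half_unique with (1 := Hi).
    replace (snd (RtoC (RGamma x))) with (0 * RGamma x) by (simpl; ring).
    apply is_RInt_half_ext with (fun t => 0 * gamma_density x t).
    + intros t _. rewrite (Rmult_0_l (ln t)), sin_0. ring.
    + now apply is_RInt_half_scal.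
Qed.

Lemma RGamma_succ (x : R) : 0 < x -> RGamma (x + 1) = x * RGamma x.
Proof.
  intros Hx. assert (H := Gamma_succ (RtoC x) Hx).
  rewrite <- RtoC_plus, !Gamma_RtoC, <- RtoC_mult in H by lra.
  now injection H.
Qed.

Lemma RGamma_1 : RGamma 1 = 1.
Proof.
  destruct (is_RInt_RGamma 1 ltac:(lra)) as [H _].
  apply is_RInt_half_unique with (1 := H).
  apply is_RInt_half_ext with (fun t => exp (- t)).
  { intros t Ht. unfold gamma_density. replace (1 - 1) with 0 by ring.
    rewrite Rpower_O by exact Ht. ring. }
  apply is_RInt_half_derive with (fun t => - exp (- t)) (- exp (- 0)) 0;
    [| | | | rewrite Ropp_0, exp_0; ring].
  - intros t _. auto_derive; [exact I | ring].
  - intros t _. apply (ex_derive_continuous (V := R_NormedModule)).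
    auto_derive. exact I.
  - apply (filterlim_filter_le_1 (F := locally 0) (G := at_right 0)).
    + apply filter_le_within.
    + apply (ex_derive_continuous (V := R_NormedModule)
               (fun t => - exp (- t))).
      auto_derive. exact I.
  - apply filterlim_locally. intros eps. pose proof (cond_pos eps) as Heps.
    exists (- ln eps). intros t Ht.
    change (Rabs (- exp (- t) - 0) < eps).
    rewrite Rminus_0_r, Rabs_Ropp, Rabs_pos_eq by apply Rlt_le, exp_pos.
    rewrite <- (exp_ln eps) by exact Heps. apply exp_increasing. lra.
Qed.

(** Chebyshev's inequality for the weight [t^{u-1} e^{-t}].  If [r] is chosen
    with [r^x Gamma(u) = Gamma(u+x)], then
    [(t^x - r^x) (t^y - r^y) >= 0] for all [t], because both factors change
    sign at [t = r]; the claim is the integral of this inequality. *)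
Lemma RGamma_chebyshev (u x y : R) :
  0 < u -> 0 < x -> 0 < y ->
  RGamma (u + x) * RGamma (u + y) <= RGamma u * RGamma (u + x + y).
Proof.
  intros Hu Hx Hy.
  destruct (is_RInt_RGamma u Hu) as [I0 P0].
  destruct (is_RInt_RGamma (u + x) ltac:(lra)) as [Ix Px].
  destruct (is_RInt_RGamma (u + y) ltac:(lra)) as [Iy Py].
  destruct (is_RInt_RGamma (u + x + y) ltac:(lra)) as [Ixy Pxy].
  set (l := ln (RGamma (u + x) / RGamma u) / x).
  set (rx := exp (x * l)). set (ry := exp (y * l)).
  assert (Hrx : RGamma (u + x) = rx * RGamma u).
  { unfold rx, l.
    replace (x * (ln (RGamma (u + x) / RGamma u) / x))
      with (ln (RGamma (u + x) / RGamma u)) by (field; lra).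
    rewrite exp_ln by now apply Rdiv_lt_0_compat. field. lra. }
  assert (HI : 0 <= RGamma (u + x + y)
                    + (- ry * RGamma (u + x)
                       + (- rx * RGamma (u + y) + rx * ry * RGamma u))).
  { eapply is_RInt_half_ge_0.
    2:{ exact (is_RInt_half_plus _ _ _ _ Ixy
                 (is_RInt_half_plus _ _ _ _ (is_RInt_half_scal _ _ _ Ix)
                    (is_RInt_half_plus _ _ _ _ (is_RInt_half_scal _ _ _ Iy)
                       (is_RInt_half_scal _ _ _ I0)))). }
    intros t Ht. simpl. rewrite !gamma_density_plus.
    set (g := gamma_density u t). assert (Hg : 0 < g) by apply gamma_density_pos.
    replace (Rpower t y * (Rpower t x * g)
             + (- ry * (Rpower t x * g) + (- rx * (Rpower t y * g) + rx * ry * g)))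
      with (g * ((Rpower t x - rx) * (Rpower t y - ry))) by ring.
    apply Rmult_le_pos; [lra|]. unfold Rpower, rx, ry.
    destruct (Rle_lt_dec l (ln t)) as [Hl|Hl].
    - apply Rmult_le_pos; apply (proj1 (Rminus_le_0 _ _)), exp_le_compat; nra.
    - rewrite <- Rmult_opp_opp, 2!Ropp_minus_distr.
      apply Rmult_le_pos; apply (proj1 (Rminus_le_0 _ _)), exp_le_compat; nra. }
  rewrite Hrx in HI |- *. nra.
Qed.

(** * The beta function bounds the coefficients *)

Lemma shifted_factorial_1_RGamma (n : nat) :
  shifted_factorial (RtoC 1) n = RtoC (RGamma (INR n + 1)).
Proof.
  pose proof (pos_INR n) as Hn.
  assert (H := Gamma_shifted_factorial (RtoC 1) n ltac:(simpl; lra)).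
  rewrite <- RtoC_plus, !Gamma_RtoC, RGamma_1, Cmult_1_r in H by lra.
  now rewrite Rplus_comm.
Qed.

(** Each shifted factorial in the coefficient is a quotient of gamma values:
    the [n]-th coefficient times [B(a,b)] is
    [Gamma(a+n) Gamma(b+n) / (Gamma(a+b+n) Gamma(n+1))].
    By [|Gamma z| <= Gamma (Re z)] and Chebyshev's inequality this is at most
    [Gamma n / Gamma (n+1)]. *)
Lemma zero_balanced_coef_Beta_le (a b : C) (n : nat) :
  admissible a b -> (1 <= n)%nat ->
  zero_balanced_coef (Re (a + b)%C) (Re (a * b)%C) n * Cmod (Beta a b)
  <= / INR n.
Proof.
  intros Hab Hn.
  destruct (admissible_real a b Hab) as (Hs & Hp & Ha & Hb & Hp0).
  assert (Hs0 : Re (a + b)%C = Re a + Re b) by reflexivity.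
  assert (HN : 0 < INR n) by (apply lt_0_INR; lia).
  assert (HA := zero_balanced_coef_pos (Re (a + b)%C) (Re (a * b)%C) n
                  ltac:(lra) Hp0).
  assert (HF := F_coef_zero_balanced a b n Hab).
  set (s := Re (a + b)%C) in *. set (A := zero_balanced_coef s _ n) in *.
  rewrite <- (Rabs_pos_eq A) by lra. rewrite <- Cmod_R, <- HF, <- Cmod_mult.
  destruct (is_RInt_RGamma s ltac:(lra)) as [_ Ps].
  destruct (is_RInt_RGamma (s + INR n) ltac:(lra)) as [_ Psn].
  destruct (is_RInt_RGamma (INR n + 1) ltac:(lra)) as [_ Pn1].
  destruct (is_RInt_RGamma (INR n) HN) as [_ Pn].
  assert (Hq : forall x, 0 < x -> RtoC x <> RtoC 0)
    by (intros x Hx H; injection H; lra).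
  assert (Gs := Gamma_shifted_factorial (RtoC s) n ltac:(simpl; lra)).
  rewrite <- RtoC_plus, !Gamma_RtoC in Gs by lra.
  assert (Hsf : shifted_factorial (RtoC s) n <> RtoC 0)
    by (apply shifted_factorial_neq_0; simpl; lra).
  assert (E : (F_coef a b (a + b) n * Beta a b)%C
    = (Gamma (a + RtoC (INR n)) * Gamma (b + RtoC (INR n))
       / (RtoC (RGamma (s + INR n)) * RtoC (RGamma (INR n + 1))))%C).
  { rewrite Gs, !Gamma_shifted_factorial by assumption.
    unfold F_coef, Beta. rewrite Hs, Gamma_RtoC by lra. rewrite shifted_factorial_1_RGamma.
    field. auto. }
  rewrite E, <- RtoC_mult, Cmod_div
    by (apply Hq; now apply Rmult_lt_0_compat).
  rewrite Cmod_mult, Cmod_R, Rabs_pos_eq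
    by (apply Rlt_le; now apply Rmult_lt_0_compat).
  assert (Ba : Cmod (Gamma (a + RtoC (INR n))) <= RGamma (INR n + Re a)).
  { replace (INR n + Re a) with (Re (a + RtoC (INR n))%C)
      by (change (Re a + INR n = INR n + Re a); ring).
    apply is_RInt_Gamma_parts. change (0 < Re a + INR n). lra. }
  assert (Bb : Cmod (Gamma (b + RtoC (INR n))) <= RGamma (INR n + Re b)).
  { replace (INR n + Re b) with (Re (b + RtoC (INR n))%C)
      by (change (Re b + INR n = INR n + Re b); ring).
    apply is_RInt_Gamma_parts. change (0 < Re b + INR n). lra. }
  assert (Hch := RGamma_chebyshev (INR n) (Re a) (Re b) HN Ha Hb).
  replace (INR n + Re a + Re b) with (s + INR n) in Hch by (rewrite Hs0; ring).
  apply Rmult_le_reg_r with (RGamma (s + INR n) * RGamma (INR n + 1));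
    [now apply Rmult_lt_0_compat|].
  rewrite (RGamma_succ (INR n)) by exact HN.
  rewrite (RGamma_succ (INR n)) in Pn1 by exact HN.
  replace (/ INR n * (RGamma (s + INR n) * (INR n * RGamma (INR n))))
    with (RGamma (INR n) * RGamma (s + INR n)) by (field; lra).
  eapply Rle_trans; [|exact Hch].
  unfold Rdiv. rewrite Rmult_assoc, Rinv_l, Rmult_1_r
    by (apply Rgt_not_eq; now apply Rmult_lt_0_compat).
  apply Rmult_le_compat; try apply Cmod_ge_0; assumption.
Qed.

(** An increasing sequence lies below any upper bound that its later terms
    satisfy up to a factor tending to 1. *)
Lemma hprime_coef_Beta_le (a b : C) (n : nat) :
  admissible a b ->
  Rmax 1 (Re (a + b)%C / 2) <= Re (a * b)%C ->
  0 < Re (Beta a b) ->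
  hprime_coef (Re (a + b)%C) (Re (a * b)%C) n * Re (Beta a b) <= 1.
Proof.
  intros Hab Hmax HB.
  destruct (admissible_real a b Hab) as (_ & _ & Ha & Hb & Hp0).
  assert (Hs0 : 0 < Re (a + b)%C)
    by (change (0 < Re a + Re b); lra).
  pose proof (Rmax_l 1 (Re (a + b)%C / 2)) as M1.
  pose proof (Rmax_r 1 (Re (a + b)%C / 2)) as M2.
  set (s := Re (a + b)%C) in *. set (p := Re (a * b)%C) in *.
  assert (Hinc : forall m, hprime_coef s p n <= hprime_coef s p (n + m)).
  { induction m as [|m IH].
    - rewrite Nat.add_0_r. apply Rle_refl.
    - rewrite Nat.add_succ_r. apply Rle_trans with (1 := IH).
      apply hprime_coef_increasing; lra. }
  assert (Hb1 : forall m, hprime_coef s p n * Re (Beta a b)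
                          <= 1 + / INR (S m)).
  { intros m.
    apply Rle_trans with (hprime_coef s p (n + S m) * Re (Beta a b)).
    - apply Rmult_le_compat_r; [lra | apply Hinc].
    - assert (H := zero_balanced_coef_Beta_le a b (n + S m) Hab ltac:(lia)).
      fold s p in H. unfold hprime_coef.
      assert (HA := zero_balanced_coef_pos s p (n + S m) Hs0 Hp0).
      set (A := zero_balanced_coef s p (n + S m)) in *.
      assert (HN : 0 < INR (n + S m)) by (apply lt_0_INR; lia).
      assert (HR : Re (Beta a b) <= Cmod (Beta a b))
        by (apply Rle_trans with (1 := Rle_abs _); apply re_le_Cmod).
      apply Rle_trans with (INR (S (n + S m)) * / INR (n + S m)).
      + rewrite Rmult_assoc. apply Rmult_le_compat_l; [apply pos_INR|].
        apply Rle_trans with (2 := H). apply Rmult_le_compat_l; lra.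
      + rewrite S_INR, Rmult_plus_distr_r, Rinv_r, Rmult_1_l by lra.
        apply Rplus_le_compat_l, Rinv_le_contravar;
          [apply lt_0_INR; lia | apply le_INR; lia]. }
  assert (HL : is_lim_seq (fun m => 1 + / INR (S m)) 1).
  { replace (Finite 1) with (Finite (1 + 0)) by (f_equal; ring).
    apply is_lim_seq_plus'; [apply is_lim_seq_const|].
    apply (is_lim_seq_incr_1 (fun m => / INR m)).
    replace (Finite 0) with (Rbar_inv p_infty) by reflexivity.
    apply is_lim_seq_inv; [apply is_lim_seq_INR | easy]. }
  exact (is_lim_seq_le _ _ (Finite _) (Finite _) Hb1
           (is_lim_seq_const _) HL).
Qed.

(** * The minimal surface *)

Lemma hprime_neq_0 (a b alpha : C) (z : C) :
  admissible a b -> in_disk z ->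
  cond_ii a b alpha \/
    (cond_i a b alpha /\ Re (a * b)%C <= Re (a + b)%C / 2) ->
  power_series (fun n => RtoC (INR (S n)) * F_coef a b (a + b) n)%C z
    <> RtoC 0.
Proof.
  intros Hab Hz Hcond.
  destruct (admissible_real a b Hab) as (_ & _ & Ha & Hb & Hp0).
  assert (Hs0 : 0 < Re (a + b)%C)
    by (change (0 < Re a + Re b); lra).
  set (s := Re (a + b)%C) in *. set (p := Re (a * b)%C) in *.
  assert (Hext : forall n, (RtoC (INR (S n)) * F_coef a b (a + b) n)%C
                           = RtoC (hprime_coef s p n)).
  { intros n. rewrite F_coef_zero_balanced by exact Hab.
    symmetry. apply RtoC_mult. }
  rewrite (power_series_ext _ _ z Hext).
  assert (Hd : disk_coefs (fun n => RtoC (hprime_coef s p n))).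
  { assert (H := disk_coefs_mul_S _ (disk_coefs_zero_balanced s p Hs0 Hp0)).
    revert H. apply disk_coefs_le. intros n. apply Req_le. f_equal.
    apply RtoC_mult. }
  destruct Hcond as [[Hmax Hal] | [[H1 _] H2]].
  - pose proof (Cmod_ge_0 alpha) as Hal0.
    assert (HB : 1 / 2 <= Re (Beta a b)) by lra.
    pose proof (Rmax_l 1 (s / 2)) as M1. pose proof (Rmax_r 1 (s / 2)) as M2.
    assert (H0 : hprime_coef s p O = 1) by (unfold hprime_coef; simpl; ring).
    apply power_series_neq_0_increasing; [exact Hd | exact Hz | | |].
    + rewrite H0. lra.
    + intros n. fold s p in Hmax. apply hprime_coef_increasing; lra.
    + intros n. rewrite H0.
      assert (H := hprime_coef_Beta_le a b n Hab Hmax ltac:(lra)).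
      fold s p in H. assert (Hn := hprime_coef_pos s p n Hs0 Hp0). nra.
  - apply power_series_neq_0_decreasing; [exact Hd | exact Hz | |].
    + intros n. now apply hprime_coef_pos.
    + intros n. now apply hprime_coef_decreasing.
Qed.

(* Regularity is asserted in case (ii), and in case (i) when ab <= (a+b)/2.
   The latter is automatic for real a, b > 0 with ab <= 1; for b = conj a it
   is not, and then (i) does not exclude branch points. *)
Theorem corollary2 (a b alpha s : C) (k : nat) (c : R)
    (hab : admissible a b)
    (hk : (1 <= k)%nat)
    (hs : (s * s)%C = alpha)
    (hcond : cond_i a b alpha \/ cond_ii a b alpha) :
  minimal_surface (lift a b alpha s k c) /\
  (cond_ii a b alpha \/ Re (a * b)%C <= Re (a + b)%C / 2 ->
   immersed (lift a b alpha s k c)) /\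
  (forall z : C, in_disk z ->
     base_projection (lift a b alpha s k c z) = f_map a b alpha k z).
Proof.
  assert (HA : disk_coefs (F_coef a b (a + b))).
  { destruct (admissible_real a b hab) as (_ & _ & Ha & Hb & Hp0).
    assert (Hs0 : 0 < Re (a + b)%C) by (change (0 < Re a + Re b); lra).
    assert (H := disk_coefs_zero_balanced _ _ Hs0 Hp0).
    revert H. apply disk_coefs_le. intros n. apply Req_le. f_equal.
    now apply F_coef_zero_balanced. }
  split; [|split].
  - assert (H0 : in_disk (RtoC 0)) by (unfold in_disk; rewrite Cmod_0; lra).
    eapply weierstrass_minimal_surface with (z := RtoC 0);
      [now apply lift_weierstrass_data | exact H0 |].
    apply lift_regular; [exact hs | exact HA | exact H0 |].
    rewrite power_series_0 by now apply disk_coefs_mul_S.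
    rewrite F_coef_zero_balanced by exact hab. simpl.
    intros H. injection H. lra.
  - intros Hreg z Hz. apply lift_regular; [exact hs | exact HA | exact Hz |].
    apply hprime_neq_0 with alpha; [exact hab | exact Hz |]. tauto.
  - intros z _. unfold base_projection. symmetry. apply surjective_pairing.
Qed.
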